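(* In the multidimensional platform game with a continuous, centrally symmetric electorate described in the context, define $$\mathcal D^\star=\arg\max_{\|e\|=1}\mathcal C(e),\qquad \mathcal C^\star=\max_{\|e\|=1}\mathcal C(e).$$ A platform profile is a global maximizer of the potential $\Phi$ on $B_R(\mu)^2$ if and only if, up to party labels, it has the form $$x_A^\star=\mu+\mathcal C^\star e^\star,\qquad x_B^\star=\mu-\mathcal C^\star e^\star\qquad\text{for some } e^\star\in\mathcal D^\star.$$ Every such profile is also a Nash equilibrium of the unrestricted game (platforms in $\mathbb R^K$). More generally, a Nash equilibrium $(x_A,x_B)$ of the unrestricted game is party-preferred if and only if its cleavage direction belongs to $\mathcal D^\star$ (that is, $x_A\ne x_B$ and $(x_A-x_B)/\|x_A-x_B\|\in\mathcal D^\star$). At every party-preferred equilibrium, $$\|x_A-x_B\|=2\mathcal C^\star,\qquad \widehat V_p^\star=\frac{\nu(1)+\nu(0)}{2}+\frac{2(\mathcal C^\star)^2}{\phi},\quad p=A,B,$$ where $\widehat V_p^\star$ is party $p$'s payoff. Hence, for fixed $\nu$ and $\phi$, both parties' maximal equilibrium payoffs increase with the maximal conflict value $\mathcal C^\star$.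
   Context: $K\ge2$. Voter bliss points follow an absolutely continuous probability distribution $\mathcal P$ on $\mathbb R^K$ with compact support, centrally symmetric around $\mu$, such that for every unit vector $e$ the cdf $F_e$ of $e^\top(X-\mu)$, $X\sim\mathcal P$, is strictly increasing between the extrema of its support. Let $R=\sup_{x\in\operatorname{supp}\mathcal P}\|x-\mu\|$ and $B_R(\mu)$ the closed ball of radius $R$ around $\mu$. Parties $A,B$ simultaneously choose platforms $x_A,x_B\in\mathbb R^K$ (unrestricted game). A voter with bliss point $x$ supports $A$ iff $\|x_B-x\|^2-\|x_A-x\|^2\ge\epsilon$, where the common shock $\epsilon$ is uniform on $[-\phi,\phi]$ and $\phi>4R^2$. $S_A(\epsilon)$ is the $\mathcal P$-mass of voters supporting $A$ and $S_B=1-S_A$. The power rule $\rho:[0,1]\to\mathbb R$ is strictly increasing, with $\rho(s)+\rho(1-s)=\bar\rho$ for all $s$, and continuous at $0$ and $1$ (interior jumps allowed); $U:[\rho(0),\rho(1)]\to\mathbb R$ is continuous, strictly increasing and strictly concave; $\nu=U\circ\rho$ with $\nu(1)-\nu(0)=1$. Payoffs are $V_p(x_A,x_B)=\mathbb E_\epsilon[\nu(S_p(\epsilon))]$. The potential is $\Phi(x_A,x_B)=V_A(x_A,x_B)-\|x_B-\mu\|^2/\phi$. Conflict value: for a unit vector $e$, $Q_e(u)=\inf\{z:F_e(z)\ge u\}$ is the quantile function of $e^\top(X-\mu)$ (support endpoints assigned at $u=0,1$). Replace $\nu$ by its right-continuous version, and let $\Lambda_\nu$ be the Lebesgue–Stieltjes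 measure on $[0,1]$ with $\Lambda_\nu((a,b])=\nu(b)-\nu(a)$ and $\Lambda_\nu(\{0\})=0$. Define $M_\nu(B)=\Lambda_\nu(\{s\in[0,1]:1-s\in B\})$ for Borel $B\subseteq[0,1]$ (a probability measure). Then $\mathcal C(e)=\int_0^1Q_e(u)\,dM_\nu(u)$. A pure-strategy Nash equilibrium of the unrestricted game is party-preferred if it maximizes each party's payoff among all pure-strategy Nash equilibria of the unrestricted game. Its cleavage direction is $(x_A-x_B)/\|x_A-x_B\|$. *)

(* Defs.v *)
From HB Require Import structures.
From mathcomp Require Import all_boot all_order all_algebra.
From mathcomp Require Import all_classical all_reals all_analysis.
From mathcomp Require Import measurable_realfun.

Set Implicit Arguments.
Unset Strict Implicit.
Unset Printing Implicit Defensive.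

Import Order.TTheory GRing.Theory Num.Theory.
Import numFieldTopology.Exports numFieldNormedType.Exports.

Local Open Scope classical_set_scope.
Local Open Scope ring_scope.

(* Points of R^K are row vectors; the norm
   that the library puts on 'rV[R]_K is the sup norm (it is used here only
   through the topology it induces), so the Euclidean norm is introduced. *)
Section euclidean.
Context {R : realType} {K : nat}.
Implicit Types (x y a b : 'rV[R]_K) (A : set 'rV[R]_K).

Definition dot x y : R := \sum_(i < K) x 0 i * y 0 i.

Definition enorm x : R := Num.sqrt (dot x x).

Definition unit_sphere : set 'rV[R]_K := [set e | enorm e = 1].

Definition eball x (r : R) : set 'rV[R]_K := [set y | enorm (y - x) <= r].

Definition box a b : set 'rV[R]_K := [set x | forall i, a 0 i <= x 0 i <= b 0 i].

Definition box_volume a b : R := \prod_(i < K) Num.max 0 (b 0 i - a 0 i).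

(* Lebesgue outer measure on R^K; its restriction to the Borel sets is
   Lebesgue measure *)
Definition lebesgue_outer A : \bar R :=
  ereal_inf [set (\sum_(0 <= k <oo) (box_volume (c k).1 (c k).2)%:E)%E
            | c in [set c : nat -> 'rV[R]_K * 'rV[R]_K |
                     A `<=` \bigcup_k box (c k).1 (c k).2]].

End euclidean.

Definition borelRV (R : realType) (K : nat) :=
  g_sigma_algebraType (@open 'rV[R]_K).

Definition measure_support (R : realType) (T : topologicalType)
    (m : set T -> \bar R) : set T :=
  [set x | forall A, open A -> A x -> (0 < m A)%E].

Section projections.
Context {R : realType} {K : nat}.
Variables (P : probability (borelRV R K) R) (mu : 'rV[R]_K).

(* law of e^T (X - mu) for X distributed according to P *)
Definition proj_law (e : 'rV[R]_K) : set (measurableTypeR R) -> \bar R :=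
  pushforward P (fun x : borelRV R K => dot e ((x : 'rV[R]_K) - mu)).

Definition proj_cdf (e : 'rV[R]_K) (z : R) : R := fine (proj_law e `]-oo, z]).

Definition proj_supp (e : 'rV[R]_K) : set R :=
  @measure_support R R (proj_law e).

End projections.

Record electorate (R : realType) (K : nat) := Electorate {
  law : probability (borelRV R K) R;
  center : 'rV[R]_K;
  law_absolutely_continuous :
    law `<< (@lebesgue_outer R K : set (borelRV R K) -> \bar R);
  law_compact_support :
    compact (@measure_support R 'rV[R]_K law);
  law_centrally_symmetric : forall A : set (borelRV R K), measurable A ->
    law [set x : borelRV R K | A (center *+ 2 - (x : 'rV[R]_K))] = law A;
  proj_cdf_increasing : forall e : 'rV[R]_K, unit_sphere e ->
    {in `[inf (proj_supp law center e), sup (proj_supp law center e)] &,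
      {homo proj_cdf law center e : y z / y < z}}
}.

Definition electorate_supp (R : realType) (K : nat) (E : electorate R K)
  : set 'rV[R]_K := @measure_support R 'rV[R]_K (law E).

Definition voter_radius (R : realType) (K : nat) (E : electorate R K) : R :=
  sup [set enorm (x - center E) | x in electorate_supp E].

(* rho and utility are total functions, only their values on [0, 1] and on
   [rho 0, rho 1] respectively are constrained or used *)
Record power_stakes (R : realType) := PowerStakes {
  rho : R -> R;
  rho_bar : R;
  utility : R -> R;
  rho_increasing : {in `[0, 1] &, {homo rho : s t / s < t}};
  rho_complement : {in `[0, 1], forall s, rho s + rho (1 - s) = rho_bar};
  rho_continuous0 : rho s @[s --> 0^'+] --> rho 0;
  rho_continuous1 : rho s @[s --> 1^'-] --> rho 1;
  utility_continuous : {within `[rho 0, rho 1], continuous utility};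
  utility_increasing : {in `[rho 0, rho 1] &, {homo utility : x y / x < y}};
  utility_strictly_concave : {in `[rho 0, rho 1] &, forall x y (t : R),
    x != y -> 0 < t < 1 -> t * utility x + (1 - t) * utility y < utility (t * x + (1 - t) * y)};
  stakes_normalized : utility (rho 1) - utility (rho 0) = 1
}.

Section power_value.
Context {R : realType}.
Variable N : power_stakes R.

Definition nu (s : R) : R := utility N (rho N s).

(* nu extended by constants outside [0, 1]; its right limits give the
   right-continuous version of nu, which agrees with nu at 0 and 1 *)
Definition nu_ext (s : R) : R := nu (Num.max 0 (Num.min s 1)).

Definition nu_right (s : R) : R := lim (nu_ext t @[t --> s^'+]).

Lemma nu_ext_nondecreasing : {homo nu_ext : s t / s <= t}.
Proof.
have nuI : {in `[0, 1] &, {homo nu : s t / s <= t}}.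
  have rhoI : {in `[0, 1] &, {homo rho N : s t / s <= t}}.
    move=> s t s01 t01; rewrite le_eqVlt => /orP[/eqP->//|st].
    exact/ltW/rho_increasing.
  have rho01 s : s \in `[0, 1] -> rho N s \in `[rho N 0, rho N 1].
    move=> s01; have /andP[s0 s1] : 0 <= s <= 1 by rewrite in_itv in s01.
    by rewrite in_itv/= !rhoI// in_itv/= lexx ler01.
  move=> s t s01 t01 st; have := rhoI _ _ s01 t01 st.
  rewrite le_eqVlt => /orP[/eqP e|rst]; first by rewrite /nu e.
  by apply/ltW/utility_increasing => //; exact: rho01.
move=> s t st; apply: nuI.
- by rewrite in_itv/= le_max lexx/= ge_max ler01 ge_min lexx orbT.
- by rewrite in_itv/= le_max lexx/= ge_max ler01 ge_min lexx orbT.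
- by rewrite ge_max le_max lexx/= le_max le_min !ge_min st lexx !orbT.
Qed.

Lemma nu_right_cvg s : nu_ext t @[t --> s^'+] --> nu_right s.
Proof.
apply: cvgP; apply: (@nondecreasing_at_right_cvgr _ _ _ +oo%O).
- by rewrite bnd_simp.
- by move=> x y _ _; exact: nu_ext_nondecreasing.
- exists (nu_ext s) => _ [x + <-]; rewrite /= in_itv/= andbT => sx.
  exact/nu_ext_nondecreasing/ltW.
Qed.

Lemma nu_right_ge s t : s <= t -> nu_ext s <= nu_right t.
Proof.
move=> st; apply: (cvgr_to_ge (@nu_right_cvg t)).
near=> x; by apply: nu_ext_nondecreasing; rewrite (le_trans st)// ltW.
Unshelve. all: by end_near. Qed.

Lemma nu_right_le s t : s < t -> nu_right s <= nu_ext t.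
Proof.
move=> st; apply: (cvgr_to_le (@nu_right_cvg s)).
near=> x; by apply: nu_ext_nondecreasing; apply: ltW; near: x; exact: nbhs_right_lt.
Unshelve. all: by end_near. Qed.

Lemma nu_right_nondecreasing : nondecreasing nu_right.
Proof.
move=> s t; rewrite le_eqVlt => /orP[/eqP->//|st].
exact: (le_trans (nu_right_le st) (nu_right_ge (lexx t))).
Qed.

Lemma nu_right_right_continuous : right_continuous nu_right.
Proof.
move=> s; apply/cvgrPdist_le => e e0.
have [d d0 Hd] : exists2 d, 0 < d & nu_ext (s + d) <= nu_right s + e.
  have /cvgrPdist_le/(_ _ e0) := @nu_right_cvg s.
  rewrite near_withinE => /nbhs_ballP[d /= d0 Hd].
  exists (d / 2); first by rewrite divr_gt0.
  have /Hd : ball s d (s + d / 2).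
    rewrite /ball/= opprD addNKr normrN gtr0_norm ?divr_gt0//.
    by rewrite ltr_pdivrMr// ltr_pMr// ltr1n.
  rewrite ltrDl divr_gt0// => /(_ isT).
  by rewrite ler_distl => /andP[]; rewrite lerBlDr.
near=> t.
have st : s < t by near: t; exact: nbhs_right_gt.
have td : t < s + d by near: t; apply: nbhs_right_lt; rewrite ltrDl.
rewrite ler0_norm; last by rewrite subr_le0; exact/nu_right_nondecreasing/ltW.
by rewrite opprB lerBlDl (le_trans (nu_right_le td)).
Unshelve. all: by end_near. Qed.

HB.instance Definition _ := isCumulative.Build R _ R nu_right
  nu_right_nondecreasing nu_right_right_continuous.

(* the extension by constants and the continuity of nu at 0 give the atom at 0
   mass 0 *)
Definition Lambda_nu : set (measurableTypeR R) -> \bar R :=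
  mrestr (lebesgue_stieltjes_measure nu_right) (measurable_itv `[0, 1]).

HB.instance Definition _ := Measure.on Lambda_nu.

Let flip (s : measurableTypeR R) : measurableTypeR R := 1 - s.

Let measurable_flip : measurable_fun [set: measurableTypeR R] flip.
Proof.
by apply: continuous_measurable_fun => x; apply: cvgB;
  [exact: cvg_cst|exact: cvg_id].
Qed.

Definition M_nu : set (measurableTypeR R) -> \bar R :=
  pushforward Lambda_nu (fun s : measurableTypeR R => 1 - s : measurableTypeR R).

HB.instance Definition _ := Measure.copy M_nu
  (measure_function_pushforward__canonical__measure_function_Measure
     Lambda_nu measurable_flip).

End power_value.

Section conflict_value.
Context {R : realType} {K : nat}.
Variables (N : power_stakes R) (E : electorate R K).

(* at u = 0 the infimum would be over all of R *)
Definition quantile (e : 'rV[R]_K) (u : R) : R :=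
  if u == 0 then inf (proj_supp (law E) (center E) e)
  else if u == 1 then sup (proj_supp (law E) (center E) e)
  else inf [set z | u <= proj_cdf (law E) (center E) e z].

Definition conflict (e : 'rV[R]_K) : R :=
  \int[M_nu N]_(u in `[0, 1]) quantile e u.

Definition Dstar : set 'rV[R]_K :=
  [set e | unit_sphere e /\
           forall e', unit_sphere e' -> conflict e' <= conflict e].

(* a supremum; it is attained as soon as Dstar is nonempty *)
Definition Cstar : R := sup [set conflict e | e in unit_sphere].

End conflict_value.

Inductive party := PartyA | PartyB.

Section game.
Context {R : realType} {K : nat}.
Variables (N : power_stakes R) (E : electorate R K) (phi : {posnum R}).
Implicit Types x : 'rV[R]_K * 'rV[R]_K.

Definition share_A x (eps : R) : R :=
  fine (law E [set v : borelRV R K |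
    eps <= enorm (x.2 - (v : 'rV[R]_K)) ^+ 2
           - enorm (x.1 - (v : 'rV[R]_K)) ^+ 2]).

Definition share (p : party) x (eps : R) : R :=
  if p is PartyA then share_A x eps else 1 - share_A x eps.

Lemma shock_range : - phi%:num < phi%:num.
Proof. by rewrite gtrN. Qed.

Definition payoff (p : party) x : R :=
  fine 'E_(uniform_prob shock_range)[fun eps => nu N (share p x eps)].

Definition potential x : R :=
  payoff PartyA x - enorm (x.2 - center E) ^+ 2 / phi%:num.

(* Nash equilibria range over all of R^K, maximizers of the potential only over
   pairs of platforms in this ball *)
Definition ball_profile : set ('rV[R]_K * 'rV[R]_K) :=
  eball (center E) (voter_radius E) `*` eball (center E) (voter_radius E).

Definition potential_maximizer x : Prop :=
  ball_profile x /\ forall y, ball_profile y -> potential y <= potential x.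

Definition nash x : Prop :=
  (forall y, payoff PartyA (y, x.2) <= payoff PartyA x) /\
  (forall y, payoff PartyB (x.1, y) <= payoff PartyB x).

Definition party_preferred x : Prop :=
  nash x /\ forall p y, nash y -> payoff p y <= payoff p x.

Definition cleavage x : 'rV[R]_K := (enorm (x.1 - x.2))^-1 *: (x.1 - x.2).

Definition symmetric_profile (e : 'rV[R]_K) : 'rV[R]_K * 'rV[R]_K :=
  (center E + Cstar N E *: e, center E - Cstar N E *: e).

Definition max_equilibrium_payoff (p : party) : R :=
  sup [set payoff p x | x in nash].

End game.

(* Main.v *)
(* Write a = x_A - mu, b = x_B - mu, r = |a - b|, e = (a - b) / r. A voter v
   supports A iff eps <= 2 r e.(v - mu) - (|a|^2 - |b|^2), so A's share at shock
   eps is 1 - F_e of an affine function of eps. Exchanging the order of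
   integration between the shock and the measure M_nu turns A's payoff, as long
   as a and b have norm at most sqrt phi - R (a radius larger than R), into
     (nu 0 + nu 1) / 2 + (r C(e) - (|a|^2 - |b|^2) / 2) / phi,
   and B's payoff is obtained by swapping the platforms. On the ball the
   potential is therefore a constant plus
     (r C(e) - r^2 / 4 - |a + b|^2 / 4) / phi,
   maximal exactly for a = - b = C(e) e with C(e) maximal; C(e) > 0 comes from the
   concavity of the utility.
   Projecting a platform on the ball brings it closer to all voters, so outside
   deviations are never profitable, and equilibrium platforms lie in the ball.
   At an equilibrium, moving along the direction e, in which C(e) does not vary,
   forces e.a = C(e) = - e.b, hence r = 2 C(e) and both payoffs are
   (nu 0 + nu 1) / 2 + 2 C(e)^2 / phi. The components of a and b orthogonal to e,
   which coincide, need not vanish: C need not be differentiable. *)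
Require Import Defs.
From HB Require Import structures.
From mathcomp Require Import all_boot all_order all_algebra.
From mathcomp Require Import all_classical all_reals all_analysis.
From mathcomp Require Import measurable_realfun ring lra.

Import Order.TTheory GRing.Theory Num.Theory.
Import numFieldTopology.Exports numFieldNormedType.Exports.

Set Implicit Arguments.
Unset Strict Implicit.
Unset Printing Implicit Defensive.

Local Open Scope classical_set_scope.
Local Open Scope ring_scope.

(** The payoff formula requires that no attainable margin leaves [[-phi, phi]], which
    [(R + |a|)^2 <= phi] and [(R + |b|)^2 <= phi] ensure. The hypothesis [phi > 4 R^2] makes
    [sqrt phi - R] strictly larger than [R], so the formula survives on a slightly larger ball: an
    equilibrium platform at distance exactly [R] can still be moved both ways along [e], and the
    equilibrium condition becomes an equality. Since [nu] may jump, the exchange of integrals is not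
    done by integration by parts: the mass of [M_nu] strictly above and strictly below each level is
    bounded, and the two resulting inequalities are opposite. Absolute continuity acts through the
    nullity of hyperplanes: ties have mass zero, so the share of B is that of A with platforms and
    shock reversed. At equal platforms every voter ties at shock 0; this case is computed apart and
    yields the payoff that each party can secure by imitation. Positivity of [C(e)] is read off the
    formula: at a symmetric profile both payoffs exceed the draw by the same multiple of [C(e)],
    while strict concavity makes their sum exceed [nu 0 + nu 1]. *)

Local Notation center := Defs.center.

(** * Euclidean geometry *)

Section euclidean_facts.
Context {R : realType} {K : nat}.
Implicit Types x y z e : 'rV[R]_K.

Lemma dotC x y : dot x y = dot y x.
Proof. by apply: eq_bigr => i _; rewrite mulrC. Qed.

Lemma dotDr x y z : dot x (y + z) = dot x y + dot x z.
Proof. by rewrite -big_split; apply: eq_bigr => i _; rewrite mxE mulrDr. Qed.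

Lemma dotZr a x y : dot x (a *: y) = a * dot x y.
Proof. by rewrite mulr_sumr; apply: eq_bigr => i _; rewrite mxE mulrCA. Qed.

Lemma dotNr x y : dot x (- y) = - dot x y.
Proof. by rewrite -scaleN1r dotZr mulN1r. Qed.

Lemma dotBr x y z : dot x (y - z) = dot x y - dot x z.
Proof. by rewrite dotDr dotNr. Qed.

Lemma dotDl x y z : dot (y + z) x = dot y x + dot z x.
Proof. by rewrite !(dotC _ x) dotDr. Qed.

Lemma dotZl a x y : dot (a *: y) x = a * dot y x.
Proof. by rewrite !(dotC _ x) dotZr. Qed.

Lemma dotNl x y : dot (- y) x = - dot y x.
Proof. by rewrite !(dotC _ x) dotNr. Qed.

Lemma dotBl x y z : dot (y - z) x = dot y x - dot z x.
Proof. by rewrite !(dotC _ x) dotBr. Qed.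

Definition dotE := (dotDl, dotDr, dotBl, dotBr, dotNl, dotNr, dotZl, dotZr).

Lemma dot_ge0 x : 0 <= dot x x.
Proof. by apply: sumr_ge0 => i _; rewrite -expr2 sqr_ge0. Qed.

Lemma enorm_sqr x : enorm x ^+ 2 = dot x x.
Proof. by rewrite sqr_sqrtr ?dot_ge0. Qed.

Lemma enorm_ge0 x : 0 <= enorm x.
Proof. exact: sqrtr_ge0. Qed.

Lemma enormZ a x : enorm (a *: x) = `|a| * enorm x.
Proof. by rewrite /enorm !dotE mulrA -expr2 sqrtrM ?sqr_ge0// sqrtr_sqr. Qed.

Lemma enormN x : enorm (- x) = enorm x.
Proof. by rewrite -scaleN1r enormZ normrN1 mul1r. Qed.

Lemma enorm0 : enorm (0 : 'rV[R]_K) = 0.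
Proof. by rewrite -(scale0r 0) enormZ normr0 mul0r. Qed.

Lemma ler_coord_enorm x i : `|x 0 i| <= enorm x.
Proof.
rewrite -sqrtr_sqr ler_sqrt; last exact: dot_ge0.
rewrite /dot (bigD1 i)//= -expr2 lerDl.
by apply: sumr_ge0 => j _; rewrite -expr2 sqr_ge0.
Qed.

Lemma enorm_eq0 x : (enorm x == 0) = (x == 0).
Proof.
apply/eqP/eqP => [x0|->]; last exact: enorm0.
apply/rowP => i; rewrite mxE; apply/eqP; rewrite -normr_le0 -x0.
exact: ler_coord_enorm.
Qed.

Lemma enorm_gt0 x : (0 < enorm x) = (x != 0).
Proof. by rewrite lt_def enorm_ge0 andbT enorm_eq0. Qed.

(** Cauchy-Schwarz: the squared norm of [dot y y *: x - dot x y *: y] is [dot y y] times the defect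
    of the squared inequality. *)
Lemma ler_dot_enorm x y : `|dot x y| <= enorm x * enorm y.
Proof.
have [->|y0] := eqVneq y 0.
  by rewrite enorm0 mulr0 -(scale0r 0) dotZr mul0r normr0.
rewrite -(@ler_pXn2r _ 2)// ?nnegrE// ?mulr_ge0 ?enorm_ge0//.
rewrite exprMn real_normK ?num_real// !enorm_sqr.
have := dot_ge0 (dot y y *: x - dot x y *: y).
have yy : 0 < dot y y by rewrite -enorm_sqr exprn_gt0// enorm_gt0.
rewrite !dotE (dotC y x) => h; rewrite -subr_ge0 -(pmulr_rge0 _ yy).
by apply: le_trans h _; rewrite le_eqVlt; apply/orP; left; apply/eqP; ring.
Qed.

Lemma ler_dot x y : dot x y <= enorm x * enorm y.
Proof. exact: le_trans (ler_norm _) (ler_dot_enorm _ _). Qed.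

Lemma ler_enormD x y : enorm (x + y) <= enorm x + enorm y.
Proof.
rewrite -(@ler_pXn2r _ 2)// ?nnegrE ?addr_ge0 ?enorm_ge0//.
rewrite sqrrD !enorm_sqr !dotE (dotC y x).
have := ler_dot x y; lra.
Qed.

Lemma enorm_sqrDZ x e (t : R) :
  enorm (x + t *: e) ^+ 2 = enorm x ^+ 2 + 2 * t * dot e x + t ^+ 2 * enorm e ^+ 2.
Proof. by rewrite !enorm_sqr !dotE (dotC x e); ring. Qed.

Lemma enorm_normalized x : x != 0 -> enorm ((enorm x)^-1 *: x) = 1.
Proof.
move=> x0; rewrite enormZ ger0_norm ?invr_ge0 ?enorm_ge0// mulVf//.
by rewrite enorm_eq0.
Qed.

Lemma continuous_dot (f g : 'rV[R]_K -> 'rV[R]_K) :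
  continuous f -> continuous g -> continuous (fun x => dot (f x) (g x)).
Proof.
move=> cf cg.
apply: continuous_big => [|i _ x].
  exact: add_continuous.
have cc (h : 'rV[R]_K -> 'rV[R]_K) : continuous h ->
    {for x, continuous (fun y => h y 0 i)}.
  move=> ch; apply: (@continuous_comp _ _ _ h (fun y : 'rV[R]_K => y 0 i)).
    exact: ch.
  exact: coord_continuous.
by apply: continuousM; exact: cc.
Qed.

Lemma continuous_enorm (f : 'rV[R]_K -> 'rV[R]_K) :
  continuous f -> continuous (fun x => enorm (f x)).
Proof.
move=> cf x; apply: (@continuous_comp _ _ _ (fun x => dot (f x) (f x)) (@Num.sqrt R)).
  exact: continuous_dot.
exact: sqrt_continuous.
Qed.

Lemma continuous_dotr e : continuous (dot e).
Proof. exact: (@continuous_dot (fun=> e) id (@cst_continuous _ _ e) (fun x => cvg_id)). Qed.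

Lemma enorm_continuous : continuous (@enorm R K).
Proof. exact: (@continuous_enorm id (fun x => cvg_id)). Qed.

Lemma compact_unit_sphere : compact (@unit_sphere R K).
Proof.
apply: bounded_closed_compact.
  exists 1; split => // M M1 x /= x1.
  rewrite [leLHS]mx_normrE; apply/bigmax_leP; split => [|[i j] _ /=].
    by rewrite (le_trans _ (ltW M1)).
  by rewrite ord1 (le_trans _ (ltW M1))// -x1 ler_coord_enorm.
rewrite (_ : unit_sphere = enorm @^-1` [set 1])//.
apply: closed_comp; last exact: closed_eq.
by move=> x _; exact: enorm_continuous.
Qed.

End euclidean_facts.

(** * Hyperplanes are Lebesgue null *)

Section null_hyperplanes.
Context {R : realType}.

(** The cell starts at the last grid point not exceeding [x]; cells are closed on both sides, so
    [x = a + l] falls in the last one. *)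
Lemma subdivision (N : nat) (a l x : R) : (0 < N)%N -> a <= x <= a + l ->
  exists k : 'I_N, a + l / N%:R * k%:R <= x <= a + l / N%:R * k.+1%:R.
Proof.
case: N => // N _ /andP[ax xal].
pose P (k : 'I_N.+1) := a + l / N.+1%:R * k%:R <= x.
have P0 : P ord0 by rewrite /P mulr0 addr0.
case: (@arg_maxnP _ ord0 P (fun k => k : nat) P0) => k Pk kmax.
exists k; rewrite [X in X && _]Pk/=.
have [kN|] := ltnP k.+1 N.+1.
  rewrite leNgt; apply/negP => /ltW h.
  by have := kmax (Ordinal kN) h; rewrite /= ltnn.
rewrite ltnS => Nk; have -> : k = N :> nat.
  by apply/eqP; rewrite eqn_leq Nk andbT -ltnS.
by rewrite divfK// pnatr_eq0.
Qed.

Context {K : nat}.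
Implicit Types (e x : 'rV[R]_K) (A : set 'rV[R]_K).

Lemma box_volume_ge0 (a b : 'rV[R]_K) : 0 <= box_volume a b.
Proof. by apply: prodr_ge0 => i _; rewrite le_max lexx. Qed.

(** A finite cover is completed by the degenerate box [(0, 0)], whose volume vanishes because
    [0 < K]: an empty product would be 1. *)
Lemma lebesgue_outer_le (s : seq ('rV[R]_K * 'rV[R]_K)) A : (0 < K)%N ->
  (forall x, A x -> exists2 b, b \in s & box b.1 b.2 x) ->
  (lebesgue_outer A <= (\sum_(b <- s) box_volume b.1 b.2)%:E)%E.
Proof.
move=> K0 As; pose c := nth (0, 0) s; apply: ereal_inf_lbound; exists c.
  move=> x /As[b bs xb]; exists (index b s) => //.
  by rewrite /c nth_index.
rewrite (@nneseries_split _ _ 0 (size s)); last first.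
  by move=> k _; rewrite lee_fin box_volume_ge0.
rewrite [X in (_ + X)%E]eseries0 ?adde0; last first.
  move=> i; rewrite add0n => si _; rewrite /c nth_default// /box_volume.
  rewrite (eq_bigr (fun=> 0)); last by move=> j _; rewrite mxE subr0 maxxx.
  by rewrite prodr_const card_ord expr0n eqn0Ngt K0.
by rewrite add0n sumEFin (big_nth (0, 0)).
Qed.

(* The cube of half-side [L] is cut into [N ^ K] cells by a grid; over each cell
   of the coordinates [j != i], the hyperplane lies in a slab of height
   [2 G h] in direction [i], itself cut into [N] slices so that boxes are
   indexed by all functions from ['I_K] to ['I_N]. *)
Lemma lebesgue_outer_hyperplane e (c L : R) : e != 0 -> 0 <= L ->
  lebesgue_outer [set x | dot e x = c /\ enorm x <= L] = 0%E.
Proof.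
move=> e0 L0; have [i ei0] : exists i, e 0 i != 0.
  apply/existsP; apply: contraNT e0; rewrite negb_exists => /forallP h.
  by apply/eqP/rowP => i; rewrite mxE; apply/eqP; have := h i; rewrite negbK.
have K0 : (0 < K)%N by exact: leq_ltn_trans (ltn_ord i).
pose G := (\sum_j `|e 0 j|) / `|e 0 i|.
have G0 : 0 <= G by rewrite divr_ge0// sumr_ge0.
apply/eqP; rewrite eq_le; apply/andP; split; last first.
  apply: le_ereal_inf_tmp => _ [b _ <-]; apply: nneseries_ge0 => n _ _.
  by rewrite lee_fin box_volume_ge0.
apply/lee_addgt0Pr => eta eta0; rewrite add0e.
(* [V / N] is the total volume: [N ^ K] boxes, each of volume [h ^ (K - 1) * w] with [w = 2 G h / N]
   and [h = 2 L / N]. *)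
pose V := G * 2 * (2 * L) ^+ K.
have V0 : 0 <= V.
  by apply: mulr_ge0; [exact: mulr_ge0|apply: exprn_ge0; exact: mulr_ge0].
have [N [N0 NV]] : exists N : nat, (0 < N)%N /\ V / N%:R <= eta.
  exists (Num.truncn (V / eta)).+1; split=> //.
  rewrite ler_pdivrMr// mulrC -ler_pdivrMr// ltW//.
  by rewrite truncnS_gt.
have N0' : (N%:R : R) != 0 by rewrite pnatr_eq0 -lt0n.
pose h := 2 * L / N%:R.
have h0 : 0 <= h by apply: divr_ge0 => //; exact: mulr_ge0.
pose p (f : {ffun 'I_K -> 'I_N}) j : R := - L + h * (f j)%:R.
pose s f := (c - \sum_(j | j != i) e 0 j * p f j) / e 0 i.
pose w : R := G * 2 * h / N%:R.
have w0 : 0 <= w.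
  by apply: divr_ge0 => //; apply: mulr_ge0 => //; exact: mulr_ge0.
pose lo (f : {ffun 'I_K -> 'I_N}) : 'rV[R]_K := \row_j
  if j == i then s f - G * h + w * (f i)%:R else p f j.
pose hi (f : {ffun 'I_K -> 'I_N}) : 'rV[R]_K := \row_j
  if j == i then s f - G * h + w * (f i).+1%:R else p f j + h.
pose bs := [seq (lo f, hi f) | f <- enum {ffun 'I_K -> 'I_N}].
have cover x : dot e x = c /\ enorm x <= L ->
    exists2 b, b \in bs & box b.1 b.2 x.
  move=> [exc xL].
  have /fin_all_exists[g Hg] j : exists k : 'I_N,
      - L + h * k%:R <= x 0 j <= - L + h * k.+1%:R.
    apply: subdivision => //.
    have := le_trans (ler_coord_enorm x j) xL; rewrite ler_norml; lra.
  pose sg := (c - \sum_(j | j != i) e 0 j * (- L + h * (g j)%:R)) / e 0 i.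
  have xsg : `|x 0 i - sg| <= G * h.
    have -> : x 0 i - sg =
        (\sum_(j | j != i) e 0 j * (- L + h * (g j)%:R - x 0 j)) / e 0 i.
      have exD : e 0 i * x 0 i + \sum_(j | j != i) e 0 j * x 0 j = c.
        by rewrite -exc /dot [RHS](bigD1 i).
      apply: (mulIf ei0); rewrite mulrBl /sg !divfK// -exD.
      under [RHS]eq_bigr do rewrite mulrBr.
      by rewrite sumrB; ring.
    rewrite normrM normfV ler_pdivrMr ?normr_gt0// mulrAC /G divfK ?normr_eq0//.
    apply: (le_trans (ler_norm_sum _ _ _)).
    rewrite mulr_suml [leRHS](bigD1 i)//= -[leLHS]add0r lerD ?mulr_ge0//.
    apply: ler_sum => j _; rewrite normrM ler_wpM2l// ler_norml.
    have := Hg j; rewrite -natr1; lra.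
  have [k Hk] : exists k : 'I_N,
      sg - G * h + w * k%:R <= x 0 i <= sg - G * h + w * k.+1%:R.
    apply: subdivision => //; move: xsg; rewrite ler_norml; lra.
  pose f := [ffun j => if j == i then k else g j].
  have sf : s f = sg.
    by congr (_ / _); congr (_ - _); apply: eq_bigr => j /negbTE ji; rewrite /p ffunE ji.
  exists (lo f, hi f); first by apply: map_f; rewrite mem_enum.
  move=> j /=; rewrite !mxE; case: eqP => [->|/eqP ji].
    by rewrite sf ffunE eqxx.
  by rewrite /p ffunE (negbTE ji); have := Hg j; rewrite -natr1 mulrDr mulr1 addrA.
apply: (le_trans (lebesgue_outer_le K0 cover)); rewrite lee_fin.
apply: le_trans NV; rewrite big_map (eq_bigr (fun=> h ^+ K.-1 * w)); last first.
  move=> f _; rewrite /box_volume (bigD1 i)//= mulrC; congr (_ * _).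
    rewrite (eq_bigr (fun=> h)) ?prodr_const ?cardC1 ?card_ord// => j /negbTE ji.
    by rewrite !mxE ji addrAC subrr add0r max_r.
  rewrite !mxE eqxx -natr1 (_ : _ - _ = w) ?max_r//; ring.
rewrite big_enum/= sumr_const card_ffun !card_ord.
rewrite le_eqVlt; apply/orP; left; apply/eqP.
rewrite -[LHS]mulr_natl natrX /V /w -[in X in _ = X](prednK K0) -[in X in X = _](prednK K0) /=.
have -> : 2 * L = h * N%:R by rewrite /h divfK.
clearbody h; rewrite exprMn !exprS; move: (h ^+ _) (N%:R ^+ _ : R) => hk Nk.
by field.
Qed.

End null_hyperplanes.

(** * The law of bliss points *)

Section borel_rV.
Context {R : realType} {K : nat}.

Lemma open_measurable_rV (A : set 'rV[R]_K) :
  open A -> measurable (A : set (borelRV R K)).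
Proof. by move=> oA; exact: sub_sigma_algebra. Qed.

Lemma closed_measurable_rV (A : set 'rV[R]_K) :
  closed A -> measurable (A : set (borelRV R K)).
Proof.
move=> /closed_openC/open_measurable_rV/measurableC; rewrite setCK; exact.
Qed.

Lemma continuous_measurable_rV (f : 'rV[R]_K -> R) : continuous f ->
  measurable_fun [set: borelRV R K] (f : borelRV R K -> measurableTypeR R).
Proof.
move=> cf; apply: (measurability (@RGenOInfty.G R)).
  exact: RGenOInfty.measurableE.
move=> _ [_ [r ->] <-]; rewrite setTI; apply: open_measurable_rV.
by apply: open_comp; [move=> x _; exact: cf|exact: rray_open].
Qed.

Lemma continuous_subr (c : 'rV[R]_K) : continuous (fun x : 'rV[R]_K => x - c).
Proof. by move=> x; apply: (@continuousB _ _ _ id (cst c)) => //; exact: cst_continuous. Qed.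

(** Balls with rational centre and radius [1 / (n + 1)] form a base indexed by a countable type, as
    needed to show that the complement of the support is null. *)
Lemma rat_ball (U : set 'rV[R]_K) (x : 'rV[R]_K) : open U -> U x ->
  exists q : 'rV[rat]_K * nat,
    let B := ball (map_mx ratr q.1 : 'rV[R]_K) q.2.+1%:R^-1 in B x /\ B `<=` U.
Proof.
move=> oU Ux; have /nbhs_ballP[d /= d0 dU] : nbhs x U by exact: open_nbhs_nbhs.
pose n := Num.truncn (2 / d); pose r : R := n.+1%:R^-1.
have r0 : 0 < r by rewrite invr_gt0.
have rd : r + r <= d.
  rewrite -mulr2n -[_ *+ 2]mulr_natl -ler_pdivlMl// /r.
  rewrite invf_ple ?posrE ?mulr_gt0 ?invr_gt0//.
  by rewrite invfM invrK; apply/ltW; rewrite truncnS_gt.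
have /fin_all_exists[q qx] i : exists q : rat, ball (ratr q : R) r (x 0 i : R).
  have : x 0 i - r < x 0 i + r by lra.
  move=> /rat_in_itvoo[q]; rewrite in_itv/= => qxr; exists q.
  by rewrite /ball/= ltr_norml; lra.
have xB : ball (map_mx ratr (\row_i q i) : 'rV[R]_K) r x.
  by split=> // i j; rewrite !mxE ord1; exact: qx.
exists (\row_i q i, n) => /=; split=> // y yB; apply: dU.
by apply: le_ball rd _ _; apply: ball_triangle yB; exact: ball_sym.
Qed.

End borel_rV.

(** * The support and hyperplanes under the law of bliss points *)

Section electorate_facts.
Context {R : realType} {K : nat} (E : electorate R K).
Let V := borelRV R K.
Implicit Types (A B : set V) (e : 'rV[R]_K) (z w : R).

Definition mass A : R := fine (law E A).

Lemma law_mass A : measurable A -> law E A = (mass A)%:E.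
Proof. by move=> mA; rewrite /mass fineK// fin_num_measure. Qed.

Lemma mass_ge0 A : 0 <= mass A.
Proof. exact/fine_ge0/measure_ge0. Qed.

Lemma mass_le1 A : measurable A -> mass A <= 1.
Proof. by move=> mA; rewrite -lee_fin -law_mass// probability_le1. Qed.

Lemma massC A : measurable A -> mass (~` A) = 1 - mass A.
Proof.
move=> mA; apply: EFin_inj; rewrite -law_mass; last exact: measurableC.
by rewrite probability_setC// law_mass.
Qed.

Lemma open_setC_electorate_supp : open (~` electorate_supp E).
Proof.
rewrite openE => x; rewrite /electorate_supp /measure_support/= => /existsNP[A].
move=> /not_implyP[oA] /not_implyP[Ax A0].
rewrite /interior; apply: (@filterS _ _ _ A); last exact: open_nbhs_nbhs.
by move=> y Ay /(_ _ oA Ay).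
Qed.

(** Each point outside the support has a null neighbourhood, hence lies in a null rational ball;
    [unpickle] enumerates these balls, which turns an arbitrary union of null sets into a countable
    one. *)
Lemma law_setC_electorate_supp : law E (~` electorate_supp E : set V) = 0%E.
Proof.
pose O (k : nat) : set V :=
  if @unpickle ('rV[rat]_K * nat)%type k is Some q then
    let B := ball (map_mx ratr q.1 : 'rV[R]_K) q.2.+1%:R^-1 in
    if `[< law E (B : set V) = 0%E >] then B else set0
  else set0.
have negO k : (law E).-negligible (O k).
  rewrite /O; case: unpickle => [q|]; last exact: negligible_set0.
  case: asboolP => [B0|_]; last exact: negligible_set0.
  apply/negligibleP => //; apply: open_measurable_rV.
  exact: ball_open.
apply: measure_negligible.
  exact: (open_measurable_rV open_setC_electorate_supp).
apply: negligibleS (negligible_bigcup negO) => x /existsNP[A].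
move=> /not_implyP[oA] /not_implyP[Ax /negP]; rewrite -leNgt => A0.
have [q [xB BA]] := rat_ball oA Ax.
exists (pickle q) => //; rewrite /O pickleK/=.
case: asboolP => // -[]; apply/eqP; rewrite -measure_le0; apply: le_trans A0.
apply: le_measure => //; rewrite inE; apply: open_measurable_rV => //.
exact: ball_open.
Qed.

(** Inclusion is asked on the support only, where distances to the centre are bounded by the
    radius. *)
Lemma ler_mass A B : measurable A -> measurable B ->
  (forall x, electorate_supp E x -> A x -> B x) -> mass A <= mass B.
Proof.
move=> mA mB AB; rewrite -lee_fin -!law_mass//.
have mS : measurable (~` electorate_supp E : set V).
  exact: (open_measurable_rV open_setC_electorate_supp).
rewrite -[leRHS]adde0 -law_setC_electorate_supp.
apply: le_trans (measureU2 _ mB mS); apply: le_measure; rewrite ?inE//.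
  exact: measurableU.
by move=> x Ax; have [/AB|] := pselect (electorate_supp E x); [left; auto|right].
Qed.

Lemma electorate_supp_nonempty : electorate_supp E !=set0.
Proof.
apply: contrapT => /set0P/negP; rewrite negbK => /eqP S0.
have := law_setC_electorate_supp; rewrite S0 setC0 probability_setT => /eqP.
by rewrite onee_eq0.
Qed.

Lemma ler_voter_radius x : electorate_supp E x ->
  enorm (x - center E) <= voter_radius E.
Proof.
move=> xS; apply: sup_upper_bound; last by exists x.
apply/compact_has_sup.
  by have [y yS] := electorate_supp_nonempty; exists (enorm (y - center E)); exists y.
apply: continuous_compact; last exact: law_compact_support.
by apply: continuous_subspaceT => y; apply: continuous_enorm; exact: continuous_subr.
Qed.

Lemma voter_radius_ge0 : 0 <= voter_radius E.
Proof.
have [x xS] := electorate_supp_nonempty.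
exact: le_trans (enorm_ge0 _) (ler_voter_radius xS).
Qed.

Definition proj e (x : V) : R := dot e ((x : 'rV[R]_K) - center E).

Lemma continuous_proj e : continuous (proj e : 'rV[R]_K -> R).
Proof.
by apply: continuous_dot; [exact: cst_continuous|exact: continuous_subr].
Qed.

Lemma measurable_proj e : measurable_fun setT (proj e : V -> measurableTypeR R).
Proof. exact: (continuous_measurable_rV (@continuous_proj e)). Qed.

Lemma measurable_proj_preimage e (B : set R) : measurable (B : set (measurableTypeR R)) ->
  measurable (proj e @^-1` B).
Proof. by move=> mB; rewrite -[X in measurable X]setTI; exact: measurable_proj. Qed.

Lemma ler_proj_radius e x : unit_sphere e -> electorate_supp E x ->
  `|proj e x| <= voter_radius E.
Proof.
move=> e1 /ler_voter_radius; apply: le_trans.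
by rewrite (le_trans (ler_dot_enorm _ _))// e1 mul1r.
Qed.

Lemma unit_sphere_neq0 e : unit_sphere e -> e != 0.
Proof. by move=> e1; rewrite -enorm_gt0 e1. Qed.

Lemma mass_hyperplane e z : e != 0 -> mass (proj e @^-1` [set z]) = 0.
Proof.
move=> e0; apply: EFin_inj; rewrite -law_mass; last exact: measurable_proj_preimage.
apply: measure_negligible; first exact: measurable_proj_preimage.
(* Bounded pieces of the hyperplane, each covered by finitely many thin boxes. *)
pose H n := [set x : 'rV[R]_K | dot e x = z + dot e (center E) /\ enorm x <= n%:R].
have mH n : measurable (H n : set V).
  apply: closed_measurable_rV; apply: closedI.
    apply: closed_comp (@closed_eq _ (z + dot e (center E))) => x _.
    exact: continuous_dotr.
  apply: closed_comp (@closed_le _ (n%:R : R)) => x _.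
  exact: enorm_continuous.
have negH n : (law E).-negligible (H n : set V).
  apply/negligibleP => //.
  (* Domination asks that every measurable subset of [H n] be null, hence the monotonicity of the
     outer measure. *)
  apply: (@law_absolutely_continuous _ _ E (H n)) => // A mA AH.
  apply/eqP; rewrite eq_le; apply/andP; split.
    rewrite -(lebesgue_outer_hyperplane (z + dot e (center E)) e0 (ler0n R n)).
    apply: ereal_inf_le_tmp => _ [c Hc <-]; exists c => //.
    exact: subset_trans Hc.
  apply: le_ereal_inf_tmp => _ [b _ <-]; apply: nneseries_ge0 => k _ _.
  by rewrite lee_fin box_volume_ge0.
apply: negligibleS (negligible_bigcup negH) => x /=.
rewrite /proj dotBr => xz; exists (Num.truncn (enorm x)).+1 => //=.
by split; [rewrite -xz subrK|rewrite ltW// truncnS_gt].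
Qed.

End electorate_facts.

(** * Projected cdfs and quantiles *)

Section projection_cdf.
Context {R : realType} {K : nat} (E : electorate R K).
Implicit Types (e : 'rV[R]_K) (u v z w : R).

Local Notation F := (proj_cdf (law E) (center E)).
Local Notation supp := (proj_supp (law E) (center E)).
Local Notation rad := (voter_radius E).

Lemma mass_setD (A B : set (borelRV R K)) : measurable A -> measurable B -> B `<=` A ->
  mass E (A `\` B) = mass E A - mass E B.
Proof.
move=> mA mB BA; apply: EFin_inj.
rewrite -law_mass; last exact: measurableD.
rewrite measureD//; last by rewrite -ge0_fin_numE// fin_num_measure.
have -> : A `&` B = B by apply/setIidPr.
by rewrite EFinB; congr (_ - _)%E; exact: law_mass.
Qed.

Lemma proj_cdfE e z : F e z = mass E [set x | proj E e x <= z].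
Proof.
by rewrite /proj_cdf /proj_law /pushforward /mass; congr (fine (law E _)).
Qed.

Lemma measurable_proj_le e z : measurable [set x | proj E e x <= z].
Proof.
rewrite (_ : [set x | _] = proj E e @^-1` `]-oo, z]).
  exact: measurable_proj_preimage.
by apply/seteqP; split => x /=; rewrite in_itv.
Qed.

Lemma measurable_proj_lt e z : measurable [set x | proj E e x < z].
Proof.
rewrite (_ : [set x | _] = proj E e @^-1` `]-oo, z[).
  exact: measurable_proj_preimage.
by apply/seteqP; split => x /=; rewrite in_itv.
Qed.

Lemma proj_cdf_ge0 e z : 0 <= F e z.
Proof. by rewrite proj_cdfE mass_ge0. Qed.

Lemma proj_cdf_le1 e z : F e z <= 1.
Proof. by rewrite proj_cdfE mass_le1//; exact: measurable_proj_le. Qed.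

Lemma ler_proj_cdf e : {homo F e : z w / z <= w}.
Proof.
move=> z w zw; rewrite !proj_cdfE; apply: ler_mass.
- exact: measurable_proj_le.
- exact: measurable_proj_le.
- by move=> x _ /= /le_trans; apply.
Qed.

Lemma proj_cdf_eq0 e z : unit_sphere e -> z < - rad -> F e z = 0.
Proof.
move=> e1 zR; apply/eqP; rewrite eq_le proj_cdf_ge0 andbT proj_cdfE.
have -> : 0 = mass E set0 by rewrite /mass measure0.
apply: ler_mass => //; first exact: measurable_proj_le.
move=> x /(ler_proj_radius e1); rewrite ler_norml => /andP[h _] /= h'.
by move: (lt_le_trans zR (le_trans h h')); rewrite ltxx.
Qed.

Lemma proj_cdf_eq1 e z : unit_sphere e -> rad <= z -> F e z = 1.
Proof.
move=> e1 zR; apply/eqP; rewrite eq_le proj_cdf_le1 proj_cdfE.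
have -> : 1 = mass E setT by rewrite /mass probability_setT.
apply: ler_mass => //; first exact: measurable_proj_le.
move=> x /(ler_proj_radius e1); rewrite ler_norml => /andP[_ h] _ /=.
exact: le_trans zR.
Qed.

Lemma proj_law_itv_oc e z w : z <= w ->
  proj_law (law E) (center E) e `]z, w] = (F e w - F e z)%:E.
Proof.
move=> zw; rewrite !proj_cdfE -mass_setD.
- rewrite -law_mass.
    rewrite /proj_law /pushforward; congr (law E _).
    apply/seteqP; split=> x /=; rewrite in_itv/=.
      by move=> /andP[h1 h2]; split=> //; apply/negP; rewrite -ltNge.
    by move=> [h1 /negP]; rewrite -ltNge => h2; apply/andP.
  by apply: measurableD; exact: measurable_proj_le.
- exact: measurable_proj_le.
- exact: measurable_proj_le.
- by move=> x /= /le_trans; apply.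
Qed.

Lemma proj_lawE e (B : set R) : measurable (B : set (measurableTypeR R)) ->
  proj_law (law E) (center E) e B = (mass E (proj E e @^-1` B))%:E.
Proof. by move=> mB; rewrite -law_mass//; exact: measurable_proj_preimage. Qed.

Lemma proj_cdf_gt0 e z w : supp e w -> w < z -> 0 < F e z.
Proof.
move=> Sw wz; rewrite -lte_fin.
apply: (lt_le_trans (Sw `]-oo, z[%classic (lray_open z) _)); first by rewrite /= in_itv.
rewrite proj_lawE// lee_fin proj_cdfE; apply: ler_mass => [||x _].
- exact: measurable_proj_preimage.
- exact: measurable_proj_le.
- by rewrite /= in_itv/= => /ltW.
Qed.

Lemma proj_cdf_lt1 e z w : supp e w -> z < w -> F e z < 1.
Proof.
move=> Sw zw; rewrite -subr_gt0 -lte_fin.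
apply: (lt_le_trans (Sw `]z, +oo[%classic (rray_open z) _)).
  by rewrite /= in_itv/= zw.
rewrite proj_lawE// lee_fin proj_cdfE -massC; last exact: measurable_proj_le.
apply: ler_mass => [||x _].
- exact: measurable_proj_preimage.
- by apply: measurableC; exact: measurable_proj_le.
- by rewrite /= in_itv/= andbT ltNge => /negP.
Qed.

(** The witness is the infimum of the points where the cdf is positive: every neighbourhood of it
    contains a half-open interval across which the cdf rises from 0 to a positive value. *)
Lemma proj_supp_le e z : unit_sphere e -> 0 < F e z -> exists2 w, supp e w & w <= z.
Proof.
move=> e1 Fz; pose G := [set t | 0 < F e t].
have lbG : lbound G (- rad).
  move=> t /= Ft; rewrite leNgt; apply/negP => /(proj_cdf_eq0 e1) h.
  by move: Ft; rewrite /G/= h ltxx.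
have G_inf : has_inf G by split; [exists z|exists (- rad)].
exists (inf G); last by apply: ge_inf; [exact: G_inf.2|].
move=> A oA AG; have /nbhs_ballP[d /= d0 dA] : nbhs (inf G) A by exact: open_nbhs_nbhs.
have [t Gt td] := inf_adherent d0 G_inf.
have d2 : 0 < d / 2 by rewrite divr_gt0.
have Gle : inf G <= t by apply: ge_inf => //; exact: G_inf.2.
have F0 : F e (inf G - d / 2) = 0.
  apply/eqP; rewrite eq_le proj_cdf_ge0 andbT leNgt; apply/negP => h.
  have : inf G <= inf G - d / 2 by apply: ge_inf => //; exact: G_inf.2.
  lra.
have : (0 < proj_law (law E) (center E) e `](inf G - d / 2)%R, t])%E.
  by rewrite proj_law_itv_oc ?F0 ?subr0//; lra.
move/lt_le_trans; apply; rewrite !proj_lawE//; last exact: open_measurable.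
rewrite lee_fin; apply: ler_mass => [||x _].
- exact: measurable_proj_preimage.
- by apply: measurable_proj_preimage; exact: open_measurable.
- rewrite /= in_itv/= => /andP[h1 h2]; apply: dA.
  by rewrite /ball/= ltr_norml; lra.
Qed.

Lemma proj_supp_ge e z : unit_sphere e -> F e z < 1 -> exists2 w, supp e w & z <= w.
Proof.
move=> e1 Fz; pose G := [set t | F e t < 1].
have ubG : ubound G rad.
  move=> t /= Ft; rewrite leNgt; apply/negP => /ltW/(proj_cdf_eq1 e1) h.
  by move: Ft; rewrite /G/= h ltxx.
have G_sup : has_sup G by split; [exists z|exists rad].
exists (sup G); last exact: sup_upper_bound.
move=> A oA AG; have /nbhs_ballP[d /= d0 dA] : nbhs (sup G) A by exact: open_nbhs_nbhs.
have [t Gt td] := sup_adherent d0 G_sup.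
have d2 : 0 < d / 2 by rewrite divr_gt0.
have Gle : t <= sup G by apply: sup_upper_bound.
have F1 : F e (sup G + d / 2) = 1.
  apply/eqP; rewrite eq_le proj_cdf_le1/= leNgt; apply/negP => h.
  have : sup G + d / 2 <= sup G by apply: sup_upper_bound.
  lra.
have : (0 < proj_law (law E) (center E) e `]t, (sup G + d / 2)%R])%E.
  by rewrite proj_law_itv_oc ?F1 ?lte_fin ?subr_gt0//; lra.
move/lt_le_trans; apply; rewrite !proj_lawE//; last exact: open_measurable.
rewrite lee_fin; apply: ler_mass => [||x _].
- exact: measurable_proj_preimage.
- by apply: measurable_proj_preimage; exact: open_measurable.
- rewrite /= in_itv/= => /andP[h1 h2]; apply: dA.
  by rewrite /ball/= ltr_norml; lra.
Qed.

Lemma ler_proj_supp e w : unit_sphere e -> supp e w -> `|w| <= rad.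
Proof.
move=> e1 Sw; rewrite ler_norml !leNgt; apply/andP; split; apply/negP => h.
- have hz : w < (w - rad) / 2 by lra.
  by have := proj_cdf_gt0 Sw hz; rewrite proj_cdf_eq0 ?ltxx//; lra.
- have hz : (w + rad) / 2 < w by lra.
  by have := proj_cdf_lt1 Sw hz; rewrite proj_cdf_eq1 ?ltxx//; lra.
Qed.

Lemma has_inf_proj_supp e : unit_sphere e -> has_inf (supp e).
Proof.
move=> e1; split; last first.
  by exists (- rad) => w /(ler_proj_supp e1); rewrite ler_norml => /andP[].
have [|w Sw _] := @proj_supp_le e rad e1; last by exists w.
by rewrite proj_cdf_eq1.
Qed.

Lemma has_sup_proj_supp e : unit_sphere e -> has_sup (supp e).
Proof.
move=> e1; split; first exact: (has_inf_proj_supp e1).1.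
by exists rad => w /(ler_proj_supp e1); rewrite ler_norml => /andP[].
Qed.

(** A positive cdf at [z] and a cdf below 1 at [w] place both points between the extrema of the
    support, where strict monotonicity is assumed. *)
Lemma ltr_proj_cdf e z w : unit_sphere e -> z < w -> 0 < F e z -> F e w < 1 -> F e z < F e w.
Proof.
move=> e1 zw Fz Fw.
have [a Sa az] := proj_supp_le e1 Fz; have [b Sb wb] := proj_supp_ge e1 Fw.
have ia : inf (supp e) <= a by apply: ge_inf => //; exact: (has_inf_proj_supp e1).2.
have bs : b <= sup (supp e) by apply: sup_upper_bound => //; exact: has_sup_proj_supp.
by apply: (proj_cdf_increasing e1) => //; rewrite in_itv/=; lra.
Qed.

(* The clauses on [0 < F e z] and [F e z < 1] cover [u = 0] and [u = 1], where
   [quantile] is an endpoint of the support; the strict bound is where the strict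
   monotonicity of the cdf enters. *)
Lemma quantile_lt e u z : unit_sphere e -> 0 <= u <= 1 -> quantile E e u < z ->
  [/\ u <= F e z, 0 < F e z & F e z < 1 -> u < F e z].
Proof.
move=> e1 /andP[u0 u1]; rewrite /quantile; case: eqP => [->|/eqP u0'].
  move=> /(inf_lt (has_inf_proj_supp e1).1)[w Sw wz].
  by have := proj_cdf_gt0 Sw wz; split => //; exact: ltW.
have {}u0 : 0 < u by rewrite lt_neqAle eq_sym u0'.
case: eqP => [->|_] qz.
  have F1 : F e z = 1.
    apply/eqP; rewrite eq_le proj_cdf_le1/= leNgt; apply/negP => /(proj_supp_ge e1)[w Sw zw].
    have : w <= sup (supp e) by apply: sup_upper_bound => //; exact: has_sup_proj_supp.
    lra.
  by rewrite F1 lexx ltr01 ltxx.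
have [|w /= uw wz] := inf_lt _ qz; first by exists rad; rewrite /= proj_cdf_eq1.
have uF : u <= F e z := le_trans uw (ler_proj_cdf e (ltW wz)).
split=> //; first exact: lt_le_trans uF.
move=> Fz; apply: (le_lt_trans uw); apply: ltr_proj_cdf => //.
exact: lt_le_trans uw.
Qed.

(** The alternative [F e z = 0] is the case [u = 0], where the quantile is the lower end of the
    support and the cdf cannot be below [u]. *)
Lemma quantile_gt e u z : unit_sphere e -> 0 <= u <= 1 -> z < quantile E e u ->
  F e z < u \/ F e z = 0.
Proof.
move=> e1 /andP[u0 u1]; rewrite /quantile; case: eqP => [->|/eqP u0'] zq.
  right; apply/eqP; rewrite eq_le proj_cdf_ge0 andbT leNgt; apply/negP.
  move=> /(proj_supp_le e1)[w Sw wz].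
  have : inf (supp e) <= w by apply: ge_inf => //; exact: (has_inf_proj_supp e1).2.
  lra.
left; have {}u0 : 0 < u by rewrite lt_neqAle eq_sym u0'.
move: zq; case: eqP => [->|_] zq.
  have [w Sw zw] := sup_gt (has_sup_proj_supp e1).1 zq.
  exact: proj_cdf_lt1 Sw zw.
rewrite ltNge; apply/negP => uF; move: zq; rewrite ltNge => /negP; apply.
apply: ge_inf => //; exists (- rad) => t /= ut; rewrite leNgt; apply/negP.
by move=> /(proj_cdf_eq0 e1) h; move: ut; rewrite h leNgt u0.
Qed.

Lemma ler_norm_quantile e u : unit_sphere e -> 0 <= u <= 1 -> `|quantile E e u| <= rad.
Proof.
move=> e1 u01; rewrite ler_norml !leNgt; apply/andP; split; apply/negP => h.
- have [//|_] := @quantile_lt e u ((quantile E e u - rad) / 2) e1 u01 _; first lra.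
  by rewrite proj_cdf_eq0 ?ltxx//; lra.
- have [//||] := @quantile_gt e u ((quantile E e u + rad) / 2) e1 u01; first lra.
    by rewrite proj_cdf_eq1//; lra.
  by rewrite proj_cdf_eq1//; lra.
Qed.

Lemma ler_quantile e u v : unit_sphere e -> 0 <= u -> u <= v -> v <= 1 ->
  quantile E e u <= quantile E e v.
Proof.
move=> e1 u0 uv v1; rewrite leNgt; apply/negP => h.
pose z := (quantile E e u + quantile E e v) / 2.
have [||vF F0 _] := @quantile_lt e v z e1; [lra|rewrite /z; lra|].
have [|||] := @quantile_gt e u z e1; [lra|rewrite /z; lra|lra|lra].
Qed.

(** For voters of the support the two projections differ by at most [d = rad * enorm (e' - e)], so
    the cdf of [e] at [z] is at most that of [e'] at [z + d]. A larger gap between the quantiles is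
    refuted at the midpoint [z]. *)
Lemma quantile_lipschitz e e' u : unit_sphere e -> unit_sphere e' -> 0 <= u <= 1 ->
  quantile E e' u <= quantile E e u + rad * enorm (e' - e).
Proof.
move=> e1 e1' u01; rewrite leNgt; apply/negP => h.
set d := rad * enorm (e' - e) in h *.
pose z := (quantile E e u + (quantile E e' u - d)) / 2.
have [|uF F0 _] := @quantile_lt e u z e1 u01; first by rewrite /z; lra.
have FF : F e z <= F e' (z + d).
  rewrite !proj_cdfE; apply: ler_mass => [||x Sx /= xz].
  - exact: measurable_proj_le.
  - exact: measurable_proj_le.
  - rewrite -[proj E e' x](subrK (proj E e x)) addrC lerD//.
    rewrite /proj -dotBl (le_trans (ler_dot _ _))// mulrC.
    by rewrite ler_wpM2r ?enorm_ge0// ler_voter_radius.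
by have [||] := @quantile_gt e' (u) (z + d) e1' u01; [rewrite /z; lra|lra|lra].
Qed.

Lemma mass_center_symmetric e (B : set R) : measurable (B : set (measurableTypeR R)) ->
  mass E (proj E (- e) @^-1` B) = mass E (proj E e @^-1` B).
Proof.
move=> mB; rewrite /mass; congr fine.
rewrite -(law_centrally_symmetric E (measurable_proj_preimage E e mB)).
congr (law E _); apply/seteqP; split => x /=;
  rewrite /proj mulr2n !dotE; congr (B _); ring.
Qed.

Lemma proj_cdfN e : F (- e) = F e.
Proof.
by apply/funext => z; rewrite /proj_cdf !proj_lawE// mass_center_symmetric.
Qed.

Lemma quantileN e : quantile E (- e) = quantile E e.
Proof.
apply/funext => u; rewrite /quantile proj_cdfN.
have -> // : supp (- e) = supp e.
apply/funext => w; apply/propext; split => Sw A oA Aw; have := Sw A oA Aw;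
  by rewrite !proj_lawE ?mass_center_symmetric//; exact: open_measurable.
Qed.

Lemma mass_proj_eq e z : e != 0 ->
  mass E [set x | proj E e x < z] = mass E [set x | proj E e x <= z].
Proof.
move=> e0; apply/eqP; rewrite eq_sym -subr_eq0 -mass_setD.
- rewrite (_ : _ `\` _ = proj E e @^-1` [set z]) ?mass_hyperplane//.
  apply/seteqP; split=> x /=.
    by move=> [h1 /negP]; rewrite -leNgt => h2; apply/eqP; rewrite eq_le h1.
  by move=> ->; rewrite lexx ltxx.
- exact: measurable_proj_le.
- exact: measurable_proj_lt.
- by move=> x /= /ltW.
Qed.

Lemma mass_projN e z : mass E [set x | - z <= proj E e x] = mass E [set x | proj E e x <= z].
Proof.
have mI (i : interval R) : measurable ([set` i] : set (measurableTypeR R)) by [].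
transitivity (mass E (proj E e @^-1` `[- z, +oo[)).
  by congr (mass E _); apply/seteqP; split=> x /=; rewrite in_itv/= andbT.
rewrite -mass_center_symmetric//; congr (mass E _).
by apply/seteqP; split=> x /=; rewrite in_itv/= andbT /proj dotNl lerN2.
Qed.

Lemma proj_cdf0 e : e != 0 -> F e 0 = 2^-1.
Proof.
move=> e0; have := massC E (measurable_proj_lt e 0).
rewrite mass_proj_eq// -proj_cdfE.
rewrite (_ : ~` _ = [set x | - 0 <= proj E e x]); last first.
  by apply/seteqP; split=> x /=; rewrite oppr0 leNgt => /negP.
rewrite mass_projN -proj_cdfE; lra.
Qed.

(** Otherwise the open half-space of positive projections would be a countable union of null sets,
    against the value 1/2 of the cdf at 0. It supplies an interval of shocks at which both parties
    have support. *)
Lemma proj_cdf_lt1_pos e : unit_sphere e -> exists2 z, 0 < z & F e z < 1.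
Proof.
move=> e1; apply: contrapT => h.
have F1 z : 0 < z -> F e z = 1.
  move=> z0; apply/eqP; rewrite eq_le proj_cdf_le1/= leNgt; apply/negP => Fz.
  by apply: h; exists z.
have neg n : (law E).-negligible (proj E e @^-1` `]n.+1%:R^-1, +oo[).
  apply/negligibleP; first exact: measurable_proj_preimage.
  apply: etrans (law_mass E (measurable_proj_preimage E e (measurable_itv _))) _.
  congr EFin; rewrite (_ : _ @^-1` _ = ~` [set x | proj E e x <= n.+1%:R^-1]).
    by rewrite (massC E (measurable_proj_le e _)) -proj_cdfE F1 ?invr_gt0// subrr.
  by apply/seteqP; split=> x /=; rewrite in_itv/= andbT ltNge => /negP.
have : mass E (~` [set x | proj E e x <= 0]) = 0.
  apply: EFin_inj; rewrite -law_mass; last by apply: measurableC; exact: measurable_proj_le.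
  apply: measure_negligible; first by apply: measurableC; exact: measurable_proj_le.
  apply: negligibleS (negligible_bigcup neg) => x /= /negP; rewrite -ltNge => x0.
  exists (Num.truncn (proj E e x)^-1) => //=; rewrite in_itv/= andbT.
  by rewrite invf_plt ?posrE// truncnS_gt.
rewrite (massC E (measurable_proj_le e 0)) -proj_cdfE proj_cdf0 ?unit_sphere_neq0//.
lra.
Qed.

End projection_cdf.

(** * The measure associated with the power value *)

Section power_value_facts.
Context {R : realType} (N : power_stakes R).
Implicit Types (s t : R).

Lemma nu1E : nu N 1 = nu N 0 + 1.
Proof. by have := stakes_normalized N; rewrite /nu; lra. Qed.

Lemma nu_extE s : 0 <= s <= 1 -> nu_ext N s = nu N s.
Proof. by move=> /andP[s0 s1]; rewrite /nu_ext min_l// max_r. Qed.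

Lemma nu_ext_le0 s : s <= 0 -> nu_ext N s = nu N 0.
Proof. by move=> s0; rewrite /nu_ext max_l// ge_min s0. Qed.

Lemma nu_ext_ge1 s : 1 <= s -> nu_ext N s = nu N 1.
Proof. by move=> s1; rewrite /nu_ext min_r// max_r. Qed.

Lemma rho_in s : 0 <= s <= 1 -> rho N s \in `[rho N 0, rho N 1].
Proof.
move=> /andP[s0 s1].
have rhole t u : 0 <= t -> t <= u -> u <= 1 -> rho N t <= rho N u.
  move=> t0; rewrite le_eqVlt => /orP[/eqP->//|tu] u1.
  by apply/ltW/rho_increasing => //; rewrite in_itv/=; lra.
by rewrite in_itv/= !rhole.
Qed.

Lemma ltr_nu s t : 0 <= s -> s < t -> t <= 1 -> nu N s < nu N t.
Proof.
move=> s0 st t1; apply: utility_increasing.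
- by apply: rho_in; lra.
- by apply: rho_in; lra.
- by apply: rho_increasing => //; rewrite in_itv/=; lra.
Qed.

Lemma ler_nu s t : 0 <= s -> s <= t -> t <= 1 -> nu N s <= nu N t.
Proof. by move=> s0; rewrite le_eqVlt => /orP[/eqP->//|st t1]; apply/ltW/ltr_nu. Qed.

(* By symmetry of [rho] both gambles have the same mean power, and the riskier
   one, between [rho 0] and [rho 1], has the smaller expected utility. *)
Lemma ltr_nu_complement s : 0 < s < 1 -> nu N 0 + nu N 1 < nu N s + nu N (1 - s).
Proof.
move=> /andP[s0 s1].
have I0 : rho N 0 \in `[rho N 0, rho N 1] by apply: rho_in; lra.
have I1 : rho N 1 \in `[rho N 0, rho N 1] by apply: rho_in; lra.
have r0 : rho N 0 < rho N s by apply: rho_increasing => //; rewrite in_itv/=; lra.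
have r1 : rho N s < rho N 1 by apply: rho_increasing => //; rewrite in_itv/=; lra.
have eqr : rho N (1 - s) = rho N 0 + rho N 1 - rho N s.
  have := @rho_complement _ N s; rewrite in_itv/= !ltW// => /(_ isT).
  have := @rho_complement _ N 0; rewrite in_itv/= lexx ler01 subr0 => /(_ isT).
  lra.
have d0 : 0 < rho N 1 - rho N 0 by lra.
pose t := (rho N 1 - rho N s) / (rho N 1 - rho N 0).
have t01 : 0 < t < 1.
  apply/andP; split; first by apply: divr_gt0 => //; lra.
  by rewrite /t ltr_pdivrMr//; lra.
have n01 : rho N 0 != rho N 1 by rewrite lt_eqF//; lra.
have dn0 : rho N 1 - rho N 0 != 0 by rewrite gt_eqF.
have := @utility_strictly_concave _ N _ _ I0 I1 t n01 t01.
have t01' : 0 < 1 - t < 1 by lra.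
have := @utility_strictly_concave _ N _ _ I0 I1 (1 - t) n01 t01'.
rewrite subKr.
rewrite (_ : (1 - t) * rho N 0 + t * rho N 1 = rho N (1 - s)); last by rewrite eqr /t; field.
rewrite (_ : t * rho N 0 + (1 - t) * rho N 1 = rho N s); last by rewrite /t; field.
rewrite /nu; lra.
Qed.

Lemma ler_nu_complement s : 0 <= s <= 1 -> nu N 0 + nu N 1 <= nu N s + nu N (1 - s).
Proof.
move=> /andP[]; rewrite le_eqVlt => /orP[/eqP<- _|s0]; first by rewrite subr0.
rewrite le_eqVlt => /orP[/eqP->|s1]; first by rewrite subrr addrC.
by apply/ltW/ltr_nu_complement; rewrite s0.
Qed.

Local Notation LS := (lebesgue_stieltjes_measure (nu_right N)).

Lemma LS_itv_oc s t : s <= t -> LS `]s, t] = (nu_right N t - nu_right N s)%:E.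
Proof.
move=> st; rewrite /lebesgue_stieltjes_measure /measure_extension/=.
by rewrite measurable_mu_extE/= ?wlength_itv_bnd//; exact: is_ocitv.
Qed.

Lemma nu_rightN1 : nu_right N (-1) = nu N 0.
Proof.
apply/eqP; rewrite eq_le; apply/andP; split.
  have h : -1 < 0 :> R by lra.
  by rewrite -(nu_ext_le0 (lexx 0)) nu_right_le.
have h : -1 <= 0 :> R by lra.
by rewrite -(nu_ext_le0 h) nu_right_ge.
Qed.

Lemma nu_right1 : nu_right N 1 = nu N 1.
Proof.
apply/eqP; rewrite eq_le; apply/andP; split.
  have h : 1 < 2 :> R by lra.
  by rewrite -(nu_ext_ge1 (ltW h)) nu_right_le.
by rewrite -(nu_ext_ge1 (lexx 1)) nu_right_ge.
Qed.

(** Leaving out [t] removes a possible jump there, so the bound holds with the value of [nu] itself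
    and not only with [nu_right]. The left end -1 stands for any point below 0. *)
Lemma LS_itv_oo t : (LS `](-1)%R, t[ <= (nu_ext N t - nu N 0)%:E)%E.
Proof.
have [t1|t1] := leP t (-1).
  rewrite set_itv_ge ?measure0 ?lee_fin ?bnd_simp -?leNgt//.
  by rewrite nu_ext_le0 ?subrr//; lra.
(* Exhaustion by half-open intervals, whose measure is an increment of [nu_right]. *)
pose G n : set (measurableTypeR R) := `]-1, t - n.+1%:R^-1]%classic.
have -> : `](-1)%R, t[%classic = \bigcup_n G n.
  apply/seteqP; split=> x; rewrite /= in_itv/=.
    move=> /andP[x1 xt]; exists (Num.truncn (t - x)^-1) => //.
    rewrite /G/= in_itv/= x1/= lerBrDr -lerBrDl.
    by rewrite invf_ple ?posrE ?subr_gt0//; apply/ltW; rewrite truncnS_gt.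
  move=> [n _]; rewrite /G/= in_itv/= => /andP[-> xt] /=.
  by rewrite (le_lt_trans xt)// ltrBlDr ltrDl invr_gt0.
have cG : LS (G n) @[n --> \oo] --> LS (\bigcup_n G n).
  apply: nondecreasing_cvg_mu => [n||m n mn].
  - exact: measurable_itv.
  - by apply: bigcup_measurable => n _; exact: measurable_itv.
  - apply/subsetPset => x; rewrite /G/= !in_itv/= => /andP[-> xm] /=.
    by rewrite (le_trans xm)// lerB// lef_pV2 ?posrE// ler_nat.
apply: (cvge_to_le cG); apply: nearW => n.
have n0 : 0 < n.+1%:R^-1 :> R by rewrite invr_gt0.
have [h|h] := leP (-1) (t - n.+1%:R^-1).
  by rewrite LS_itv_oc// lee_fin nu_rightN1 lerD2r nu_right_le// ltrBlDr ltrDl.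
rewrite /G set_itv_ge ?measure0; last by rewrite bnd_simp -leNgt ltW.
by rewrite lee_fin subr_ge0 -nu_rightN1 nu_right_le.
Qed.

Lemma M_nuE (B : set (measurableTypeR R)) :
  M_nu N B = LS ((fun s : R => 1 - s) @^-1` B `&` `[0, 1]).
Proof. by []. Qed.

Lemma measurable_preimage_flip (B : set (measurableTypeR R)) : measurable B ->
  measurable ((fun s : measurableTypeR R => 1 - s) @^-1` B `&` `[0, 1]).
Proof.
move=> mB; apply: measurableI; last exact: measurable_itv.
rewrite -[X in measurable X]setTI.
have : measurable_fun [set: measurableTypeR R] (fun s : measurableTypeR R => 1 - s).
  apply: continuous_measurable_fun => x.
  by apply: cvgB; [exact: cvg_cst|exact: cvg_id].
exact.
Qed.

(** Strict tails omit the atom of [M_nu] at [f] that a jump of [nu] at [1 - f] creates; this bound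
    and the next one hold for whatever value [nu] takes at that jump. *)
Lemma M_nu_gt f : 0 <= f <= 1 -> (M_nu N `]f, +oo[ <= (nu N (1 - f) - nu N 0)%:E)%E.
Proof.
move=> f01; rewrite M_nuE -(@nu_extE (1 - f)); last lra.
apply: le_trans (LS_itv_oo _); apply: le_measure; rewrite ?inE.
- exact: measurable_preimage_flip.
- exact: measurable_itv.
- by move=> s; rewrite /= !in_itv/=; lra.
Qed.

Lemma M_nu_lt f : 0 <= f <= 1 -> (M_nu N `]-oo, f[ <= (nu N 1 - nu N (1 - f))%:E)%E.
Proof.
move=> f01; apply: (@le_trans _ _ (LS `](1 - f)%R, 1%R])).
  rewrite M_nuE; apply: le_measure; rewrite ?inE.
  - exact: measurable_preimage_flip.
  - exact: measurable_itv.
  - by move=> s; rewrite /= !in_itv/=; lra.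
rewrite LS_itv_oc; last lra.
rewrite lee_fin nu_right1 lerB// -(@nu_extE (1 - f)); last lra.
exact: nu_right_ge.
Qed.

Lemma M_nu_setT : M_nu N setT = 1%E.
Proof.
rewrite M_nuE preimage_setT setTI.
have LS0 : LS `]-1, 0[ = 0%E.
  apply/eqP; rewrite -measure_le0; apply: le_trans (LS_itv_oo 0) _.
  by rewrite nu_ext_le0// subrr.
have LS1 : LS `]-1, 1] = 1%E.
  by rewrite LS_itv_oc ?nu_right1 ?nu_rightN1 ?nu1E; [congr EFin; lra|lra].
apply/eqP; rewrite eq_le; apply/andP; split.
  rewrite -[leRHS]LS1; apply: le_measure; rewrite ?inE; try exact: measurable_itv.
  by move=> s; rewrite /= !in_itv/=; lra.
rewrite -[leLHS]LS1 -[leRHS]add0e -LS0.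
apply: (le_trans _ (measureU2 LS (measurable_itv `]-1, 0[) (measurable_itv `[0, 1]))).
apply: le_measure; rewrite ?inE; try exact: measurable_itv.
  by apply: measurableU; exact: measurable_itv.
move=> s; rewrite /= !in_itv/= => h; have [s0|s0] := ltP s 0; [left|right]; lra.
Qed.

HB.instance Definition _ := Measure_isProbability.Build _ _ _ (M_nu N) M_nu_setT.

End power_value_facts.

(** * Averages from tail bounds *)

Section bounded_integrals.
Context d (T : measurableType d) {R : realType}.
Implicit Types (f : T -> R).

Lemma norm_le_integrable (m : {measure set T -> \bar R}) (D : set T) f (b : R) :
  measurable D -> (m D < +oo)%E -> measurable_fun D f ->
  (forall x, D x -> `|f x| <= b) -> m.-integrable D (EFin \o f).
Proof.
move=> mD Doo mf fb; apply: measurable_bounded_integrable => //.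
exists b; split; first exact: num_real.
by move=> M bM x Dx /=; rewrite (le_trans (fb _ Dx))// ltW.
Qed.

Lemma Rintegral_EFin (m : {measure set T -> \bar R}) (D : set T) f : measurable D ->
  m.-integrable D (EFin \o f) -> (\int[m]_(x in D) (f x)%:E)%E = (\int[m]_(x in D) f x)%:E.
Proof. by move=> mD mf; rewrite /Rintegral fineK//; exact: integrable_fin_num. Qed.

End bounded_integrals.

(** * Exchanging the shock and the measure *)

Section mean_of_tails.
Context {R : realType}.
Local Notation leb := (@lebesgue_measure R).
Local Notation TR := (measurableTypeR R).

Lemma lebesgue_segment (a b : R) : a <= b -> leb `[a, b] = (b - a)%:E.
Proof.
move=> ab; rewrite lebesgue_measure_itv/= lte_fin; case: ltgtP ab => //= -> _.
by rewrite subrr.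
Qed.

Lemma lebesgue_segment_lty (a b : R) : (leb `[a, b] < +oo)%E.
Proof. by rewrite lebesgue_measure_itv/=; case: ifP => _; rewrite -?EFinB ltry. Qed.

Lemma Rintegral_segment_cst (a b c : R) : a <= b -> \int[leb]_(z in `[a, b]) c = c * (b - a).
Proof.
move=> ab; rewrite Rintegral_cst; last exact: measurable_itv.
by congr (_ * _); exact: (congr1 fine (lebesgue_segment ab)).
Qed.

Lemma measure_sections (m1 m2 : {sigma_finite_measure set TR -> \bar R})
  (A : set (TR * TR)) : measurable A ->
  (\int[m1]_x m2 (xsection A x) = \int[m2]_y m1 (ysection A y))%E.
Proof.
move=> mA; have := indic_fubini_tonelli m1 m2 mA.
by rewrite indic_fubini_tonelli_FE// indic_fubini_tonelli_GE.
Qed.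

Variables (M : probability TR R) (g psi : R -> R) (phi : R).
Hypotheses (phi0 : 0 < phi) (mg : measurable_fun [set: TR] (g : TR -> TR))
  (mpsi : measurable_fun [set: TR] (psi : TR -> TR)).
Hypotheses (g_le : forall u, `|g u| <= phi) (psi_ge0 : forall z, 0 <= psi z)
  (psi_le1 : forall z, psi z <= 1).

Let D : set TR := `[- phi, phi]%classic.

Let mD : measurable D. Proof. exact: measurable_itv. Qed.

Let iM (f : R -> R) (b : R) : measurable_fun [set: TR] (f : TR -> TR) ->
  (forall u, `|f u| <= b) -> M.-integrable setT (EFin \o f).
Proof.
move=> mf fb; apply: (@norm_le_integrable _ _ _ M setT f b) => //.
by rewrite -ge0_fin_numE//; exact: fin_num_measure.
Qed.

Let iL (f : R -> R) (b : R) : measurable_fun [set: TR] (f : TR -> TR) ->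
  (forall u, `|f u| <= b) -> leb.-integrable D (EFin \o f).
Proof.
move=> mf fb; apply: (@norm_le_integrable _ _ _ leb D f b) => //.
- exact: lebesgue_segment_lty.
- exact: measurable_funS mf.
Qed.

(** One-sided exchange of integrals: the area of [A] is the integral of [h] by sections at fixed
    [u], and at most that of [k] by sections at fixed [z]. It serves for the regions under and over
    the graph of [g]. *)
Let ge0_sections_le (A : set (TR * TR)) (h k : R -> R) (b : R) : measurable A ->
  measurable_fun [set: TR] (h : TR -> TR) -> measurable_fun [set: TR] (k : TR -> TR) ->
  (forall u, 0 <= h u <= b) -> (forall z, 0 <= k z <= 1) ->
  (forall u, leb (xsection A u) = (h u)%:E) ->
  (A `<=` [set p | D p.2]) ->
  (forall z, (M (ysection A z) <= (k z)%:E)%E) ->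
  \int[M]_u h u <= \int[leb]_(z in D) k z.
Proof.
move=> mA mh mk hb k01 lA AD Mk.
have ih : M.-integrable setT (EFin \o h).
  by apply: (iM (b := b)) => // u; have /andP[h0 h1] := hb u; rewrite ger0_norm.
have ik : leb.-integrable D (EFin \o k).
  by apply: (iL (b := 1)) => // u; have /andP[h0 h1] := k01 u; rewrite ger0_norm.
rewrite -lee_fin -!Rintegral_EFin//.
have -> : (\int[M]_u (h u)%:E = \int[M]_u leb (xsection A u))%E.
  by apply: eq_integral => u _; exact/esym/lA.
rewrite (measure_sections M leb mA) [leRHS]integral_mkcond.
apply: ge0_le_integral => //.
- exact: measurable_fun_ysection.
- apply/measurable_restrict => //; rewrite setTI.
  by apply/measurable_EFinP; exact: measurable_funS mk.
- move=> z _; rewrite patchE; case: ifPn => [|/negP zD]; first by move=> _; exact: Mk.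
  rewrite (_ : ysection A z = set0) ?measure0//.
  rewrite -subset0 => u; rewrite /ysection/= inE => /AD/= Dz.
  by apply: zD; rewrite inE.
Qed.

(* Bounding both tails from above replaces the layer-cake identity, which would
   have to account for the jumps of [psi]. *)
Lemma mean_of_tails :
  (forall z, (M [set u | (z < g u)%R] <= (psi z)%:E)%E) ->
  (forall z, (M [set u | (g u < z)%R] <= (1 - psi z)%:E)%E) ->
  \int[leb]_(z in `[- phi, phi]) psi z = phi + \int[M]_u g u.
Proof.
move=> Mgt Mlt.
have ig : M.-integrable setT (EFin \o g) by apply: iM g_le.
have ipsi : leb.-integrable D (EFin \o psi).
  by apply: (iL (b := 1)) => // z; rewrite ger0_norm.
have ic (c : R) : M.-integrable setT (EFin \o cst c).
  by apply: (iM (b := `|c|)).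
have mgp : measurable_fun [set: TR * TR] (fun p : TR * TR => g p.1 : TR).
  exact: measurableT_comp mg measurable_fst.
have mA1 : measurable [set p : TR * TR | - phi <= p.2 /\ p.2 < g p.1].
  rewrite (_ : [set p | _] = (snd @^-1` `[- phi, +oo[) `&`
    ((fun p : TR * TR => p.2 < g p.1) @^-1` [set true])); last first.
    by apply/seteqP; split=> p /=; rewrite in_itv/= andbT.
  apply: measurableI; rewrite -[X in measurable X]setTI.
    by apply: measurable_snd => //; exact: measurable_itv.
  by apply: measurable_fun_ltr => //; exact: measurable_snd.
have mA2 : measurable [set p : TR * TR | g p.1 < p.2 /\ p.2 <= phi].
  rewrite (_ : [set p | _] = ((fun p : TR * TR => g p.1 < p.2) @^-1` [set true]) `&`
    (snd @^-1` `]-oo, phi])); last first.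
    by apply/seteqP; split=> p /=; rewrite in_itv/=.
  apply: measurableI; rewrite -[X in measurable X]setTI.
    by apply: measurable_fun_ltr => //; exact: measurable_snd.
  by apply: measurable_snd => //; exact: measurable_itv.
have gE u : - phi <= g u <= phi by rewrite -ler_norml.
have h1 : \int[M]_u (g u + phi) <= \int[leb]_(z in D) psi z.
  apply: (ge0_sections_le (b := 2 * phi) mA1) => //.
  - by apply: measurable_funD => //; exact: measurable_cst.
  - by move=> u; have := gE u; lra.
  - by move=> z; rewrite psi_ge0 psi_le1.
  - move=> u; rewrite (_ : xsection _ u = `[- phi, g u[%classic); last first.
      by apply/seteqP; split=> z; rewrite /xsection/= in_itv/= inE/= => /andP.
    rewrite lebesgue_measure_itv/= lte_fin; have := gE u.
    case: ltP => [_ _|h h']; first by rewrite -EFinB opprK.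
    by congr EFin; lra.
  - by move=> p /= [h1 h2]; have := gE p.1; rewrite /D/= in_itv/=; lra.
  - move=> z; apply: le_trans (Mgt z); apply: le_measure; rewrite ?inE.
    + exact: measurable_ysection.
    + rewrite -[X in measurable X]setTI.
      by apply: (@measurable_fun_ltr _ TR R setT (cst z) g) => //; exact: measurable_cst.
    + by move=> u; rewrite /ysection/= inE/= => -[].
have h2 : \int[M]_u (phi - g u) <= \int[leb]_(z in D) (1 - psi z).
  apply: (ge0_sections_le (b := 2 * phi) mA2) => //.
  - by apply: measurable_funB => //; exact: measurable_cst.
  - by apply: measurable_funB => //; exact: measurable_cst.
  - by move=> u; have := gE u; lra.
  - by move=> z; have := psi_ge0 z; have := psi_le1 z; lra.
  - move=> u; rewrite (_ : xsection _ u = `]g u, phi]%classic); last first.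
      by apply/seteqP; split=> z; rewrite /xsection/= in_itv/= inE/= => /andP.
    rewrite lebesgue_measure_itv/= lte_fin; have := gE u.
    case: ltP => [_ _|h h']; first by rewrite -EFinB.
    by congr EFin; lra.
  - by move=> p /= [h1' h2]; have := gE p.1; rewrite /D/= in_itv/=; lra.
  - move=> z; apply: le_trans (Mlt z); apply: le_measure; rewrite ?inE.
    + exact: measurable_ysection.
    + rewrite -[X in measurable X]setTI.
      by apply: (@measurable_fun_ltr _ TR R setT g (cst z)) => //; exact: measurable_cst.
    + by move=> u; rewrite /ysection/= inE/= => -[].
have M1 (c : R) : \int[M]_u c = c.
  by rewrite Rintegral_cst// -[RHS]mulr1; congr (_ * _); exact: (congr1 fine (probability_setT M)).
have e1 : \int[M]_u (g u + phi) = \int[M]_u g u + phi.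
  by rewrite RintegralD// ?M1//; exact: ic.
have e2 : \int[M]_u (phi - g u) = phi - \int[M]_u g u.
  by rewrite RintegralB// ?M1//; exact: ic.
have e3 : \int[leb]_(z in D) (1 - psi z) = 2 * phi - \int[leb]_(z in D) psi z.
  rewrite RintegralB//; last first.
    by apply: (iL (b := 1)) => [|z]; [exact: measurable_cst|rewrite normr1].
  congr (_ - _); rewrite (@Rintegral_segment_cst (- phi) phi); last by rewrite -subr_ge0 opprK addr_ge0 ?ltW.
  by rewrite opprK mul1r; lra.
(* The areas under and over the graph add up to [2 * phi], so the two bounds are opposite
   inequalities on the same integral. *)
by move: h1 h2; rewrite e1 e2 e3 -/D; lra.
Qed.

End mean_of_tails.

(** * Expectation under the uniform shock *)

Section uniform_mean.
Context {R : realType} (phi : {posnum R}).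
Local Notation leb := (@lebesgue_measure R).
Local Notation TR := (measurableTypeR R).

Lemma uniform_mean (f : R -> R) (b : R) : measurable_fun [set: TR] (f : TR -> TR) ->
  (forall z, `|f z| <= b) ->
  fine 'E_(uniform_prob (shock_range phi))[f] =
  (2 * phi%:num)^-1 * \int[leb]_(z in `[- phi%:num, phi%:num]) f z.
Proof.
move=> mf fb; set P := uniform_prob _.
have phi0 : 0 < phi%:num by [].
(* The density formula is applied to the nonnegative function [f + b]; linearity then removes the
   shift. *)
have mfb : measurable_fun [set: TR] (fun z => f z + b : TR).
  by apply: measurable_funD => //; exact: measurable_cst.
have fb0 z : 0 <= f z + b by have := fb z; rewrite ler_norml; lra.
have Poo : (P setT < +oo)%E by rewrite -ge0_fin_numE//; exact: fin_num_measure.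
have i1 : P.-integrable setT (EFin \o f) by apply: (@norm_le_integrable _ _ _ P setT f b).
have i2 : P.-integrable setT (EFin \o cst b).
  by apply: (@norm_le_integrable _ _ _ P setT _ `|b|).
have i3 : leb.-integrable `[- phi%:num, phi%:num] (EFin \o f).
  apply: (@norm_le_integrable _ _ _ leb _ f b) => //.
  - exact: lebesgue_segment_lty.
  - exact: measurable_funS mf.
have i4 : leb.-integrable `[- phi%:num, phi%:num] (EFin \o cst b).
  apply: (@norm_le_integrable _ _ _ leb _ _ `|b|) => //.
  exact: lebesgue_segment_lty.
have E1 : \int[P]_z (f z + b) = \int[P]_z f z + b.
  rewrite RintegralD// Rintegral_cst//; congr (_ + _); rewrite -[RHS]mulr1.
  by congr (_ * _); exact: (congr1 fine (probability_setT P)).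
have E2 : \int[P]_z (f z + b) =
    (2 * phi%:num)^-1 * \int[leb]_(z in `[- phi%:num, phi%:num]) (f z + b).
  rewrite {1}/Rintegral /P integral_uniform//; last first.
    by apply/measurable_EFinP.
  rewrite Rintegral_EFin//; first by rewrite -EFinM/= opprK -mulr2n mulr_natl.
  apply: (@norm_le_integrable _ _ _ leb _ _ (b + `|b|)) => //.
  - exact: lebesgue_segment_lty.
  - exact: measurable_funS mfb.
  - by move=> z _; rewrite (le_trans (ler_normD _ _))// lerD2r.
rewrite unlock -[LHS]/(Rintegral P setT f).
rewrite -[LHS](addrK b) -E1 E2 RintegralD//.
rewrite Rintegral_segment_cst; last lra.
by field.
Qed.

(** Exchanging the parties changes the sign of the margin, hence of the shock; the uniform law does
    not see this. *)
Lemma Rintegral_segment_opp (f : R -> R) (b : R) : measurable_fun [set: TR] (f : TR -> TR) ->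
  (forall z, `|f z| <= b) ->
  \int[leb]_(z in `[- phi%:num, phi%:num]) f (- z) =
  \int[leb]_(z in `[- phi%:num, phi%:num]) f z.
Proof.
move=> mf fb; rewrite /Rintegral; congr fine.
set D : set TR := `[- phi%:num, phi%:num]%classic.
have DN : D = (-%R : TR -> TR) @^-1` D.
  by apply/seteqP; split=> z; rewrite /D/= !in_itv/=; lra.
transitivity (\int[pushforward leb (-%R : TR -> TR)]_(z in D) (f z)%:E)%E; last first.
  by apply: eq_measure_integral => A mA _; exact: lebesgue_measureN.
have mDN : measurable ((-%R : TR -> TR) @^-1` D) by rewrite -DN; exact: measurable_itv.
have DNoo : (leb ((-%R : TR -> TR) @^-1` D) < +oo)%E.
  by rewrite -DN; exact: lebesgue_segment_lty.
rewrite integral_pushforward//=.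
- by congr (integral leb _ _); exact: DN.
- exact/measurable_EFinP.
- apply: (@norm_le_integrable _ _ _ leb _ (fun z => f (- z)) b) => //.
  by apply: measurable_funTS; exact: measurableT_comp.
- exact: measurable_itv.
Qed.

End uniform_mean.

(** * Payoffs *)

Section positive_integral.
Context {R : realType}.
Local Notation leb := (@lebesgue_measure R).
Local Notation TR := (measurableTypeR R).

(** With a zero integral [f] would vanish almost everywhere, against its positivity on a segment of
    positive length. Positivity at a single point would not do, as [nu] of a share can jump. *)
Lemma Rintegral_gt0 (f : R -> R) (phi a b c : R) :
  measurable_fun [set: TR] (f : TR -> TR) ->
  (forall z, 0 <= f z <= c) -> - phi <= a -> a < b -> b <= phi ->
  (forall z, a <= z <= b -> 0 < f z) -> 0 < \int[leb]_(z in `[- phi, phi]) f z.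
Proof.
move=> mf f0 phia ab bphi fgt0.
have mD : measurable (`[- phi, phi]%classic : set TR) by exact: measurable_itv.
have int_f : leb.-integrable `[- phi, phi] (EFin \o f).
  apply: (@norm_le_integrable _ _ _ leb _ f c) => //.
  - exact: lebesgue_segment_lty.
  - exact: measurable_funS mf.
  - by move=> z _; have /andP[h1 h2] := f0 z; rewrite ger0_norm.
rewrite lt_neqAle Rintegral_ge0 ?andbT; last by move=> z _; have /andP[] := f0 z.
apply/eqP => /esym intf0.
have : (\int[leb]_(z in `[(- phi)%R, phi]) `|(f z)%:E| = 0)%E.
  under eq_integral => z _.
    rewrite gee0_abs; last by rewrite lee_fin; have /andP[] := f0 z.
    over.
  by rewrite Rintegral_EFin// intf0.
move/ae_eq_integral_abs => /(_ mD)[].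
  by apply/measurable_EFinP; exact: measurable_funS mf.
move=> A [mA A0 nA].
have : (leb `[a, b] <= leb A)%E.
  apply: le_measure; rewrite ?inE//.
  move=> z; rewrite /= in_itv/= => zab; apply: nA => /= h.
  have Dz : - phi <= z <= phi by lra.
  by have := fgt0 _ zab; case: (h Dz) => ->; rewrite ltxx.
by rewrite A0 (lebesgue_segment (ltW ab)) lee_fin; lra.
Qed.

End positive_integral.

(** * Shares and comparison of payoffs *)

Section payoff_calculus.
Context {R : realType} (N : power_stakes R) {K : nat} (E : electorate R K) (phi : {posnum R}).
Local Notation leb := (@lebesgue_measure R).
Local Notation TR := (measurableTypeR R).
Local Notation rad := (voter_radius E).
Local Notation c0 := (center E).
Implicit Types (x : 'rV[R]_K * 'rV[R]_K) (v : 'rV[R]_K) (z : R) (p : party).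

Definition support_margin x v : R := enorm (x.2 - v) ^+ 2 - enorm (x.1 - v) ^+ 2.

Definition norm_gap x : R := enorm (x.1 - c0) ^+ 2 - enorm (x.2 - c0) ^+ 2.

Lemma support_margin_swap x v : support_margin (x.2, x.1) v = - support_margin x v.
Proof. by rewrite /support_margin/= opprB. Qed.

Lemma support_margin_dot x v :
  support_margin x v = 2 * dot (x.1 - x.2) (v - c0) - norm_gap x.
Proof.
rewrite /support_margin /norm_gap !enorm_sqr !dotE !(dotC v) !(dotC c0).
ring.
Qed.

Lemma cleavageE x : enorm (x.1 - x.2) *: cleavage x = x.1 - x.2.
Proof.
have [->|d0] := eqVneq (x.1 - x.2) 0; first by rewrite enorm0 scale0r.
by rewrite /cleavage scalerA divff ?scale1r// enorm_eq0.
Qed.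

Lemma support_marginE x v : support_margin x v =
  2 * enorm (x.1 - x.2) * proj E (cleavage x) v - norm_gap x.
Proof. by rewrite support_margin_dot -{1}cleavageE dotZl mulrA. Qed.

Lemma unit_cleavage x : x.1 != x.2 -> unit_sphere (cleavage x).
Proof. by move=> x12; apply: enorm_normalized; rewrite subr_eq0. Qed.

Lemma measurable_margin_ge x z :
  measurable ([set v | z <= support_margin x v] : set (borelRV R K)).
Proof.
pose f (v : borelRV R K) : TR :=
  2 * enorm (x.1 - x.2) * proj E (cleavage x) v - norm_gap x.
have mf : measurable_fun setT f.
  apply: measurable_funB; last exact: measurable_cst.
  by apply: measurable_funM; [exact: measurable_cst|exact: measurable_proj].
rewrite (_ : [set v | _] = f @^-1` `[z, +oo[).
  by rewrite -[X in measurable X]setTI; apply: mf => //; exact: measurable_itv.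
by apply/seteqP; split=> v /=; rewrite in_itv/= andbT support_marginE.
Qed.

Lemma share_AE x z : share_A E x z = mass E [set v | z <= support_margin x v].
Proof. by []. Qed.

Lemma share_A01 x z : 0 <= share_A E x z <= 1.
Proof. by rewrite share_AE mass_ge0 mass_le1//; exact: measurable_margin_ge. Qed.

Lemma share01 p x z : 0 <= share E p x z <= 1.
Proof. by case: p => /=; have := share_A01 x z; lra. Qed.

Lemma share_A_ge_supp x y z w :
  (forall v, electorate_supp E v -> z <= support_margin x v -> w <= support_margin y v) ->
  share_A E x z <= share_A E y w.
Proof.
by move=> h; rewrite !share_AE; apply: ler_mass => //; exact: measurable_margin_ge.
Qed.

Lemma share_A_noninc x : {homo share_A E x : z w /~ z <= w}.
Proof. by move=> z w wz; apply: share_A_ge_supp => v _; exact: le_trans. Qed.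

Lemma nu_share_bounds p x z : nu N 0 <= nu N (share E p x z) <= nu N 0 + 1.
Proof.
have /andP[s0 s1] := share01 p x z.
by rewrite -nu1E !ler_nu.
Qed.

Lemma measurable_nu_share p x :
  measurable_fun [set: TR] (fun z => nu N (share E p x z) : TR).
Proof.
case: p => /=.
- apply: nonincreasing_measurable => // z w zw; apply: ler_nu.
  + by have /andP[] := share_A01 x w.
  + exact: share_A_noninc.
  + by have /andP[] := share_A01 x z.
- apply: nondecreasing_measurable => // z w zw; apply: ler_nu.
  + by have := share_A01 x z; lra.
  + by rewrite lerB// share_A_noninc.
  + by have := share_A01 x w; lra.
Qed.

Let nb : R := `|nu N 0| + 1.

Let nu_share_norm p x z : `|nu N (share E p x z)| <= nb.
Proof.
have := nu_share_bounds p x z; have := ler_norm (nu N 0); have := ler_norm (- nu N 0).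
by rewrite normrN /nb ler_norml; lra.
Qed.

Lemma payoffE p x : payoff N E phi p x =
  (2 * phi%:num)^-1 * \int[leb]_(z in `[- phi%:num, phi%:num]) nu N (share E p x z).
Proof. exact: (uniform_mean phi (measurable_nu_share p x) (nu_share_norm p x)). Qed.

Lemma integrable_nu_share p x :
  leb.-integrable `[- phi%:num, phi%:num] (EFin \o (fun z => nu N (share E p x z))).
Proof.
apply: (@norm_le_integrable _ _ _ leb _ _ nb) => //.
- exact: lebesgue_segment_lty.
- exact: measurable_funS (measurable_nu_share p x).
Qed.

Lemma ler_payoff p x y : (forall z, share E p x z <= share E p y z) ->
  payoff N E phi p x <= payoff N E phi p y.
Proof.
move=> xy; rewrite !payoffE ler_pM2l//; apply: le_Rintegral.
- exact: measurable_itv.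
- exact: integrable_nu_share.
- exact: integrable_nu_share.
- move=> z _; apply: ler_nu => //.
  + by have /andP[] := share01 p x z.
  + by have /andP[] := share01 p y z.
Qed.

Lemma ltr_payoff p x y (a b : R) : (forall z, share E p x z <= share E p y z) ->
  - phi%:num <= a -> a < b -> b <= phi%:num ->
  (forall z, a <= z <= b -> share E p x z < share E p y z) ->
  payoff N E phi p x < payoff N E phi p y.
Proof.
move=> xy pa ab bp slt; rewrite !payoffE ltr_pM2l// -subr_gt0 -RintegralB.
- apply: (@Rintegral_gt0 _ _ phi%:num a b 1) => // [|z|z zab].
  + by apply: measurable_funB; exact: measurable_nu_share.
  + have := nu_share_bounds p x z; have := nu_share_bounds p y z.
    have : nu N (share E p x z) <= nu N (share E p y z).
      by apply: ler_nu => //; [have /andP[] := share01 p x z|have /andP[] := share01 p y z].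
    lra.
  + rewrite subr_gt0 ltr_nu ?slt//.
    * by have /andP[] := share01 p x z.
    * by have /andP[] := share01 p y z.
- exact: measurable_itv.
- exact: integrable_nu_share.
- exact: integrable_nu_share.
Qed.

Let phi_le : - phi%:num <= phi%:num. Proof. by rewrite -subr_ge0 opprK addr_ge0. Qed.

(** The null shock [phi] is excluded so that, when the share is not constant, its drop occurs
    strictly before [phi] and leaves room for an interval of shocks. *)
Lemma payoff_cst p x (s : R) : (forall z, - phi%:num <= z < phi%:num -> share E p x z = s) ->
  payoff N E phi p x = nu N s.
Proof.
move=> xs; rewrite payoffE.
rewrite -(@Rintegral_itv_bndo_bndc _ (BLeft (- phi%:num)) phi%:num); last first.
  apply: (integrableS _ _ _ (integrable_nu_share p x)); try exact: measurable_itv.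
  by apply: subset_itvl; rewrite bnd_simp.
rewrite (@eq_Rintegral _ _ _ leb _ (cst (nu N s))); last first.
  by move=> z; rewrite inE/= in_itv/= => zD; rewrite xs.
rewrite Rintegral_itv_bndo_bndc; last first.
  apply: (@norm_le_integrable _ _ _ leb _ _ `|nu N s|) => //.
  apply: le_lt_trans (lebesgue_segment_lty (- phi%:num) phi%:num).
  apply: le_measure; rewrite ?inE; try exact: measurable_itv.
  by apply: subset_itvl; rewrite bnd_simp.
by rewrite Rintegral_segment_cst//; field.
Qed.

(** The shares are complementary at each shock, so the concavity inequality for [nu] integrates; a
    whole segment of interior shares makes it strict. *)
Lemma payoff_sum_gt (x : 'rV[R]_K * 'rV[R]_K) (a b : R) :
  - phi%:num <= a -> a < b -> b <= phi%:num ->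
  (forall z, a <= z <= b -> 0 < share_A E x z < 1) ->
  nu N 0 + nu N 1 < payoff N E phi PartyA x + payoff N E phi PartyB x.
Proof.
move=> pa ab bp s01; rewrite !payoffE -mulrDr -RintegralD; last 3 first.
- exact: measurable_itv.
- exact: integrable_nu_share.
- exact: integrable_nu_share.
rewrite ltr_pdivlMl// -subr_gt0.
have -> : 2 * phi%:num * (nu N 0 + nu N 1) =
    \int[leb]_(z in `[- phi%:num, phi%:num]) (nu N 0 + nu N 1).
  by rewrite Rintegral_segment_cst//; ring.
rewrite -RintegralB.
- apply: (@Rintegral_gt0 _ _ phi%:num a b 2) => // [|z|z zab].
  + apply: measurable_funB; last exact: measurable_cst.
    by apply: measurable_funD; exact: measurable_nu_share.
  + have := nu_share_bounds PartyA x z; have := nu_share_bounds PartyB x z.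
    have := ler_nu_complement N (share_A01 x z).
    by rewrite /= nu1E; lra.
  + by rewrite subr_gt0 ltr_nu_complement// s01.
- exact: measurable_itv.
- apply: (@norm_le_integrable _ _ _ leb _ _ (nb + nb)) => //.
  + exact: lebesgue_segment_lty.
  + apply: measurable_funTS.
    by apply: measurable_funD; [exact: (measurable_nu_share PartyA)|exact: (measurable_nu_share PartyB)].
  + by move=> z _; rewrite (le_trans (ler_normD _ _))// lerD.
- apply: (@norm_le_integrable _ _ _ leb _ _ `|nu N 0 + nu N 1|) => //.
  exact: lebesgue_segment_lty.
Qed.

(** The function [s] only shares its integral with the actual share: for party B at equal platforms
    it is the share at the opposite shock. *)
Lemma payoff_of_tails p x (M : probability TR R) (g : R -> R) (s : R -> R) :
  measurable_fun [set: TR] (g : TR -> TR) -> (forall u, `|g u| <= phi%:num) ->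
  \int[leb]_(z in `[- phi%:num, phi%:num]) nu N (share E p x z) =
    \int[leb]_(z in `[- phi%:num, phi%:num]) nu N (s z) ->
  measurable_fun [set: TR] (fun z => nu N (s z) : TR) -> (forall z, 0 <= s z <= 1) ->
  (forall z, (M [set u | (z < g u)%R] <= (nu N (s z) - nu N 0)%:E)%E) ->
  (forall z, (M [set u | (g u < z)%R] <= (nu N 1 - nu N (s z))%:E)%E) ->
  payoff N E phi p x = (nu N 0 + nu N 1) / 2 + (\int[M]_u g u) / (2 * phi%:num).
Proof.
move=> mg gphi xs ms s01 Mgt Mlt; rewrite payoffE xs.
have nus z : nu N 0 <= nu N (s z) <= nu N 0 + 1.
  by have /andP[s0 s1] := s01 z; rewrite -nu1E !ler_nu.
have := @mean_of_tails _ M g (fun z => nu N (s z) - nu N 0) phi%:num _ mg _ gphi _ _ Mgt _.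
move=> h.
have {h} : \int[leb]_(z in `[- phi%:num, phi%:num]) (nu N (s z) - nu N 0) =
    phi%:num + \int[M]_u g u.
  apply: h => // [|z|z|z].
  - by apply: measurable_funB => //; exact: measurable_cst.
  - by have := nus z; lra.
  - by have := nus z; lra.
  - by apply: le_trans (Mlt z) _; rewrite lee_fin nu1E; lra.
rewrite RintegralB; last 3 first.
- exact: measurable_itv.
- apply: (@norm_le_integrable _ _ _ leb _ _ nb) => //.
  + exact: lebesgue_segment_lty.
  + exact: measurable_funS ms.
  + move=> z _; have := nus z; have := ler_norm (nu N 0); have := ler_norm (- nu N 0).
    by rewrite normrN /nb ler_norml; lra.
- apply: (@norm_le_integrable _ _ _ leb _ _ `|nu N 0|) => //.
  exact: lebesgue_segment_lty.
rewrite (Rintegral_segment_cst _ phi_le) => h.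
have -> : \int[leb]_(z in `[- phi%:num, phi%:num]) nu N (s z) =
   phi%:num + \int[M]_u g u + nu N 0 * (phi%:num - - phi%:num) by rewrite -h; ring.
by rewrite nu1E; field.
Qed.

End payoff_calculus.

(** * Regularity of the conflict value *)

Section conflict_facts.
Context {R : realType} (N : power_stakes R) {K : nat} (E : electorate R K).
Local Notation TR := (measurableTypeR R).
Local Notation rad := (voter_radius E).
Implicit Types (e : 'rV[R]_K) (u : R).

(** Extends the quantile by constants to a monotone bounded function on the line, so that it can be
    integrated over the whole probability space. *)
Definition clamp u : R := Num.max 0 (Num.min u 1).

Lemma clamp01 u : 0 <= clamp u <= 1.
Proof. by rewrite /clamp le_max lexx/= ge_max ler01 ge_min lexx orbT. Qed.

Lemma clamp_id u : 0 <= u <= 1 -> clamp u = u.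
Proof. by move=> /andP[u0 u1]; rewrite /clamp min_l// max_r. Qed.

Lemma ler_clamp : {homo clamp : u v / u <= v}.
Proof.
by move=> u v uv; rewrite /clamp ge_max le_max lexx/= le_max le_min !ge_min uv lexx !orbT.
Qed.

Lemma clamp_gt u t : 0 <= t -> t < clamp u -> t < u.
Proof. by move=> t0; rewrite /clamp lt_max lt_min ltNge t0/= => /andP[]. Qed.

Lemma clamp_lt u t : t <= 1 -> clamp u < t -> u < t.
Proof. by move=> t1; rewrite /clamp gt_max gt_min (ltNge 1) t1 orbF => /andP[]. Qed.

Local Notation Q e u := (quantile E e (clamp u)).

Lemma measurable_quantile_clamp e : unit_sphere e ->
  measurable_fun [set: TR] (fun u => Q e u : TR).
Proof.
move=> e1; apply: nondecreasing_measurable => // u v uv.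
have /andP[cu0 _] := clamp01 u; have /andP[_ cv1] := clamp01 v.
by apply: ler_quantile => //; exact: ler_clamp.
Qed.

Lemma norm_quantile_clamp e u : unit_sphere e -> `|Q e u| <= rad.
Proof. by move=> e1; apply: ler_norm_quantile => //; exact: clamp01. Qed.

Lemma integrable_quantile_clamp e : unit_sphere e ->
  (M_nu N).-integrable setT (EFin \o (fun u => Q e u)).
Proof.
move=> e1; apply: (@norm_le_integrable _ _ _ (M_nu N) setT _ rad) => //.
- by rewrite -ge0_fin_numE//; exact: fin_num_measure.
- exact: measurable_quantile_clamp.
- by move=> u _; exact: norm_quantile_clamp.
Qed.

Lemma conflictE e : unit_sphere e -> conflict N E e = \int[M_nu N]_u Q e u.
Proof.
move=> e1; rewrite /conflict.
rewrite (@eq_Rintegral _ _ _ (M_nu N) _ (fun u => Q e u)); last first.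
  by move=> u; rewrite inE/= in_itv/= => u01; rewrite clamp_id.
rewrite /Rintegral; congr fine; apply/esym.
have mI : measurable (`[0, 1]%classic : set TR) by exact: measurable_itv.
rewrite (@negligible_integral _ _ _ (M_nu N) setT (~` `[0, 1]%classic)) //.
- by rewrite setTD setCK.
- exact: measurableC.
- exact: integrable_quantile_clamp.
- apply: etrans (M_nuE N _) _; rewrite (_ : _ `&` _ = set0) ?measure0//.
  by rewrite -subset0 => s /=; rewrite !in_itv/= => -[h1 h2]; apply: h1; lra.
Qed.

Lemma conflictN e : conflict N E (- e) = conflict N E e.
Proof. by rewrite /conflict quantileN. Qed.

Lemma Rintegral_M_nu_cst (c : R) : \int[M_nu N]_u c = c.
Proof.
rewrite Rintegral_cst// -[RHS]mulr1; congr (_ * _).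
exact: (congr1 fine (probability_setT (M_nu N))).
Qed.

Let integrable_cst (c : R) : (M_nu N).-integrable setT (EFin \o (cst c : TR -> R)).
Proof.
apply: (@norm_le_integrable _ _ _ (M_nu N) setT _ `|c|) => //.
by rewrite -ge0_fin_numE//; exact: fin_num_measure.
Qed.

Lemma conflict_le e e' (c : R) : unit_sphere e -> unit_sphere e' ->
  (forall u, 0 <= u <= 1 -> quantile E e u <= quantile E e' u + c) ->
  conflict N E e <= conflict N E e' + c.
Proof.
move=> e1 e1' h; rewrite !conflictE// -[X in _ + X]Rintegral_M_nu_cst -RintegralD//.
- apply: le_Rintegral => //.
  + exact: integrable_quantile_clamp.
  + apply: (@norm_le_integrable _ _ _ (M_nu N) setT _ (rad + `|c|)) => //.
    * by rewrite -ge0_fin_numE//; exact: fin_num_measure.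
    * by apply: measurable_funD; [exact: measurable_quantile_clamp|exact: measurable_cst].
    * by move=> u _; rewrite (le_trans (ler_normD _ _))// lerD2r norm_quantile_clamp.
  + by move=> u _; apply: h; exact: clamp01.
- exact: integrable_quantile_clamp.
- exact: integrable_cst.
Qed.

Lemma conflict_le_radius e : unit_sphere e -> conflict N E e <= rad.
Proof.
move=> e1; rewrite -[leRHS]Rintegral_M_nu_cst conflictE//; apply: le_Rintegral => //.
- exact: integrable_quantile_clamp.
- exact: integrable_cst.
- by move=> u _; exact: le_trans (ler_norm _) (norm_quantile_clamp u e1).
Qed.

(** The pointwise bound on quantiles survives integration because [M_nu] has mass 1. It gives the
    continuity from which a maximizing direction on the compact sphere is obtained. *)
Lemma conflict_lipschitz e e' : unit_sphere e -> unit_sphere e' ->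
  `|conflict N E e - conflict N E e'| <= rad * enorm (e - e').
Proof.
move=> e1 e1'; rewrite ler_distl lerBlDr; apply/andP; split.
  by rewrite -enormN opprB; apply: conflict_le => // u u01; exact: quantile_lipschitz.
by apply: conflict_le => // u u01; exact: quantile_lipschitz.
Qed.


End conflict_facts.

(** * Payoffs in terms of the conflict value *)

Section payoff_formula.
Context {R : realType} (N : power_stakes R) {K : nat} (E : electorate R K) (phi : {posnum R}).
Local Notation leb := (@lebesgue_measure R).
Local Notation TR := (measurableTypeR R).
Local Notation rad := (voter_radius E).
Local Notation c0 := (center E).
Local Notation payoff := (payoff N E phi).
Implicit Types (x : 'rV[R]_K * 'rV[R]_K) (v : 'rV[R]_K) (z : R) (p : party).

Definition tie_payoff : R := (nu N 0 + nu N 1) / 2.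

Lemma share_A_diag v z : share_A E (v, v) z = if z <= 0 then 1 else 0.
Proof.
have margin0 w : support_margin (v, v) w = 0 by rewrite /support_margin subrr.
rewrite share_AE; case: leP => z0.
  rewrite (_ : [set w | _] = setT) ?/mass ?probability_setT//.
  by apply/seteqP; split=> w //= _; rewrite margin0.
rewrite (_ : [set w | _] = set0) ?/mass ?measure0//.
by apply/seteqP; split=> w //=; rewrite margin0 leNgt z0.
Qed.

(** All voters switch sides at shock 0, which is the tail criterion with [g = 0]. The formula with a
    cleavage direction excludes this case. *)
Lemma payoff_diag p v : payoff p (v, v) = tie_payoff.
Proof.
have mc (b : bool) : measurable ([set _ | b] : set TR).
  case: b.
    have -> : ([set _ | true] : set TR) = setT by apply/seteqP; split.
    exact: measurableT.
  have -> : ([set _ | false] : set TR) = set0 by apply/seteqP; split.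
  exact: measurable0.
have main (s : R -> R) : \int[leb]_(z in `[- phi%:num, phi%:num]) nu N (share E p (v, v) z) =
    \int[leb]_(z in `[- phi%:num, phi%:num]) nu N (s z) ->
    measurable_fun [set: TR] (fun z => nu N (s z) : TR) -> (forall z, 0 <= s z <= 1) ->
    (forall z, z < 0 -> s z = 1) -> (forall z, 0 < z -> s z = 0) -> payoff p (v, v) = tie_payoff.
  move=> xs ms s01 s1 s0.
  rewrite (@payoff_of_tails _ N _ E phi p (v, v) (M_nu N) (cst 0) s) //.
  - by rewrite Rintegral_M_nu_cst mul0r addr0.
  - by move=> u; rewrite normr0.
  - move=> z /=; have [z0|z0] := ltP z 0.
      apply: le_trans (probability_le1 (M_nu N) (mc _)) _.
      by rewrite s1// nu1E lee_fin; lra.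
    rewrite (_ : [set _ | _] = set0); last by rewrite -subset0 => u.
    rewrite measure0 lee_fin subr_ge0.
    by have /andP[? ?] := s01 z; exact: ler_nu.
  - move=> z /=; have [z0|z0] := ltP 0 z.
      apply: le_trans (probability_le1 (M_nu N) (mc _)) _.
      by rewrite s0// nu1E lee_fin; lra.
    rewrite (_ : [set _ | _] = set0); last by rewrite -subset0 => u.
    rewrite measure0 lee_fin subr_ge0.
    by have /andP[? ?] := s01 z; exact: ler_nu.
case: p main => main.
- apply: (main (share_A E (v, v))) => // [|z|z z0|z z0].
  + exact: (measurable_nu_share N E PartyA).
  + exact: share_A01.
  + by rewrite share_A_diag ltW.
  + by rewrite share_A_diag leNgt z0.
(* B's share increases with the shock, whereas [main] expects 1 before 0 and 0 after it; hence the
   reflection. *)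
- apply: (main (fun z => share E PartyB (v, v) (- z))) => [||z|z z0|z z0].
  + apply/esym; apply: (@Rintegral_segment_opp _ phi _ (`|nu N 0| + 1)).
      exact: (measurable_nu_share N E PartyB).
    move=> z; have := nu_share_bounds N E PartyB (v, v) z.
    have := ler_norm (nu N 0); have := ler_norm (- nu N 0).
    by rewrite normrN ler_norml; lra.
  + by apply: measurableT_comp (measurable_nu_share N E PartyB (v, v)) _.
  + exact: share01.
  + by rewrite /= share_A_diag oppr_le0 leNgt z0 subr0.
  + by rewrite /= share_A_diag oppr_le0 ltW// subrr.
Qed.

(** The complement of a closed half-space is open and its boundary is null. With equal platforms
    there is no half-space and all voters tie at once, hence the hypothesis. *)
Lemma share_swap x z : x.1 != x.2 -> share E PartyB x z = share E PartyA (x.2, x.1) (- z).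
Proof.
move=> x12; rewrite /= !share_AE -massC; last exact: measurable_margin_ge.
have r0 : 0 < 2 * enorm (x.1 - x.2) by rewrite mulr_gt0// enorm_gt0 subr_eq0.
have e0 := unit_sphere_neq0 (unit_cleavage x12).
pose t := (z + norm_gap E x) / (2 * enorm (x.1 - x.2)).
transitivity (mass E [set v | proj E (cleavage x) v < t]).
  congr (mass E _); apply/seteqP; split=> v /=; rewrite (support_marginE E) /t ltr_pdivlMr//.
    by move=> /negP; rewrite -ltNge => h; lra.
  by move=> h; apply/negP; rewrite -ltNge; lra.
rewrite mass_proj_eq//; congr (mass E _).
apply/seteqP; split=> v /=; rewrite support_margin_swap (support_marginE E) /t ler_pdivlMr//;
  by move=> h; lra.
Qed.

Lemma payoff_swap x : payoff PartyB x = payoff PartyA (x.2, x.1).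
Proof.
case: x => a b; have [->|ab] := eqVneq a b; first by rewrite !payoff_diag.
rewrite !payoffE; congr (_ * _).
rewrite -(@Rintegral_segment_opp _ phi (fun z => nu N (share E PartyA (b, a) z)) (`|nu N 0| + 1)).
- by apply: eq_Rintegral => z _; rewrite share_swap.
- exact: (measurable_nu_share N E PartyA).
- move=> z; have := nu_share_bounds N E PartyA (b, a) z.
  have := ler_norm (nu N 0); have := ler_norm (- nu N 0).
  by rewrite normrN ler_norml; lra.
Qed.

Lemma share_A_cdf x z : x.1 != x.2 ->
  share_A E x z = 1 - proj_cdf (law E) c0 (cleavage x)
    ((z + norm_gap E x) / (2 * enorm (x.1 - x.2))).
Proof.
move=> x12; have r0 : 0 < 2 * enorm (x.1 - x.2) by rewrite mulr_gt0// enorm_gt0 subr_eq0.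
have e0 := unit_sphere_neq0 (unit_cleavage x12).
rewrite share_AE proj_cdfE -mass_proj_eq// -massC; last exact: measurable_proj_lt.
congr (mass E _); apply/seteqP; split=> v /=; rewrite (support_marginE E) ltr_pdivlMr//.
  by move=> h; apply/negP; rewrite -leNgt; lra.
by move=> /negP; rewrite -leNgt => h; lra.
Qed.

Lemma norm_gapE x : norm_gap E x = enorm (x.1 - x.2) *
  (dot (cleavage x) (x.1 - c0) + dot (cleavage x) (x.2 - c0)).
Proof.
rewrite mulrDr -!dotZl cleavageE /norm_gap !enorm_sqr !dotE !(dotC c0) (dotC x.2 x.1).
ring.
Qed.

Lemma cleavage_gap x : x.1 != x.2 ->
  dot (cleavage x) (x.1 - c0) - dot (cleavage x) (x.2 - c0) = enorm (x.1 - x.2).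
Proof.
move=> x12; rewrite -dotBr opprB addrA subrK.
have -> : dot (cleavage x) (x.1 - x.2) = enorm (x.1 - x.2) * dot (cleavage x) (cleavage x).
  by rewrite -dotZr cleavageE.
by rewrite -enorm_sqr (unit_cleavage x12) expr1n mulr1.
Qed.

Lemma payoff_conflict x : x.1 != x.2 ->
  (rad + enorm (x.1 - c0)) ^+ 2 <= phi%:num ->
  (rad + enorm (x.2 - c0)) ^+ 2 <= phi%:num ->
  payoff PartyA x = tie_payoff +
    (enorm (x.1 - x.2) * conflict N E (cleavage x) - norm_gap E x / 2) / phi%:num.
Proof.
move=> x12 h1 h2; set e := cleavage x; set r := enorm _; set k := norm_gap E x.
have e1 : unit_sphere e by exact: unit_cleavage.
have r0 : 0 < r by rewrite /r enorm_gt0 subr_eq0.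
pose al := dot e (x.1 - c0); pose be := dot e (x.2 - c0).
have alb : `|al| <= enorm (x.1 - c0).
  by rewrite (le_trans (ler_dot_enorm _ _))// e1 mul1r.
have beb : `|be| <= enorm (x.2 - c0).
  by rewrite (le_trans (ler_dot_enorm _ _))// e1 mul1r.
have ker : k = r * (al + be) by exact: norm_gapE.
have r2 : 0 < 2 * r by rewrite mulr_gt0.
have rE : al - be = r by exact: cleavage_gap.
(* The margin of a voter whose projection is the [u]-quantile. By [gE] it is a difference of two
   squares, each between 0 and [phi], so the shock interval does not truncate it. *)
pose g u := 2 * r * quantile E e (clamp u) - k.
have sq_le (w t : R) : `|w| <= rad -> `|t| <= enorm (x.1 - c0) \/ `|t| <= enorm (x.2 - c0) ->
    (w - t) ^+ 2 <= phi%:num.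
  move=> wR tt.
  have [s hs hs2] : exists2 s, `|t| <= s & (rad + s) ^+ 2 <= phi%:num.
    by case: tt => tt; [exists (enorm (x.1 - c0))|exists (enorm (x.2 - c0))].
  apply: le_trans hs2; rewrite -real_normK ?num_real//.
  have s0 : 0 <= s := le_trans (normr_ge0 t) hs.
  apply: lerXn2r; rewrite ?nnegrE ?addr_ge0 ?voter_radius_ge0//.
  by apply: le_trans (ler_normB _ _) _; exact: lerD.
have gE u : g u = (quantile E e (clamp u) - be) ^+ 2 - (quantile E e (clamp u) - al) ^+ 2.
  by rewrite /g ker -rE; ring.
have Qr u : `|quantile E e (clamp u)| <= rad by exact: norm_quantile_clamp.
have gphi u : `|g u| <= phi%:num.
  have := sq_le _ al (Qr u) (or_introl alb); have := sq_le _ be (Qr u) (or_intror beb).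
  have := sqr_ge0 (quantile E e (clamp u) - be); have := sqr_ge0 (quantile E e (clamp u) - al).
  by rewrite gE ler_norml; lra.
have mg : measurable_fun [set: TR] (g : TR -> TR).
  apply: measurable_funB; last exact: measurable_cst.
  by apply: measurable_funM; [exact: measurable_cst|exact: measurable_quantile_clamp].
pose F z := proj_cdf (law E) c0 e z.
pose zt z := (z + k) / (2 * r).
have SF z : share_A E x z = 1 - F (zt z) by exact: share_A_cdf.
have F01 z : 0 <= F z <= 1 by rewrite proj_cdf_ge0 proj_cdf_le1.
have mgt z : measurable ([set u | z < g u] : set TR).
  rewrite -[X in measurable X]setTI.
  by apply: (@measurable_fun_ltr _ TR R setT (cst z) g) => //; exact: measurable_cst.
have mlt z : measurable ([set u | g u < z] : set TR).
  rewrite -[X in measurable X]setTI.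
  by apply: (@measurable_fun_ltr _ TR R setT g (cst z)) => //; exact: measurable_cst.
rewrite (@payoff_of_tails _ N _ E phi PartyA x (M_nu N) g (share_A E x)) //.
- rewrite RintegralB//; last 2 first.
  + apply: (@norm_le_integrable _ _ _ (M_nu N) setT _ (2 * r * rad)) => //.
    * by rewrite -ge0_fin_numE//; exact: fin_num_measure.
    * by apply: measurable_funM; [exact: measurable_cst|exact: measurable_quantile_clamp].
    * move=> u _; rewrite normrM (gtr0_norm r2).
      by apply: ler_wpM2l => //; exact/ltW/mulr_gt0.
  + apply: (@norm_le_integrable _ _ _ (M_nu N) setT _ `|k|) => //.
    by rewrite -ge0_fin_numE//; exact: fin_num_measure.
  rewrite Rintegral_M_nu_cst RintegralZl//; last exact: integrable_quantile_clamp.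
  by rewrite -conflictE// /tie_payoff; field.
- exact: (measurable_nu_share N E PartyA).
- exact: share_A01.
(* Where the cdf is 0, [quantile_gt] gives no strict inequality on [u], but A's share is 1 and the
   trivial bound by total mass is enough. *)
- move=> z; rewrite SF; have [F0|F0] := eqVneq (F (zt z)) 0.
    apply: le_trans (probability_le1 (M_nu N) (mgt z)) _.
    by rewrite F0 subr0 nu1E lee_fin; lra.
  apply: le_trans (M_nu_gt N (F01 (zt z))); apply: le_measure; rewrite ?inE.
  + exact: mgt.
  + exact: measurable_itv.
  + move=> u /= zg; rewrite in_itv/= andbT.
    have ztQ : zt z < quantile E e (clamp u).
      by rewrite /zt ltr_pdivrMr ?mulr_gt0// mulrC -ltrBrDr.
    case: (quantile_gt e1 (clamp01 u) ztQ) => [h|/eqP]; last by rewrite (negbTE F0).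
    by apply: clamp_gt h; rewrite proj_cdf_ge0.
(* Symmetrically, where the cdf is 1 the strict clause of [quantile_lt] is void and total mass is
   again enough. *)
- move=> z; rewrite SF; have [F1|F1] := eqVneq (F (zt z)) 1.
    apply: le_trans (probability_le1 (M_nu N) (mlt z)) _.
    by rewrite F1 subrr nu1E lee_fin; lra.
  apply: le_trans (M_nu_lt N (F01 (zt z))); apply: le_measure; rewrite ?inE.
  + exact: mlt.
  + exact: measurable_itv.
  + move=> u /= zg; rewrite in_itv/=.
    have ztQ : quantile E e (clamp u) < zt z.
      by rewrite /zt ltr_pdivlMr ?mulr_gt0// mulrC -ltrBlDr.
    have [_ _ h] := quantile_lt e1 (clamp01 u) ztQ.
    have /andP[_ F1'] := F01 (zt z).
    by apply: clamp_lt (h _) => //; rewrite lt_neqAle F1.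
Qed.

End payoff_formula.

(** * Nash equilibria *)

(** Among steps of length at most [d / 2] from [a] to [b], one must carry part of the drop.
    Localizing it below [d] allows comparison with a uniform gain [d] in voters' margins, without
    continuity of [f]. *)
Lemma noninc_drop {R : realType} (f : R -> R) (a b d : R) :
  {homo f : s t /~ s <= t} -> 0 < d -> a <= b -> f b < f a ->
  exists st : R * R, [/\ a <= st.1, st.1 < st.2, st.2 <= b, st.2 < st.1 + d & f st.2 < f st.1].
Proof.
move=> fni d0; have [n] : exists n : nat, b - a <= d / 2 * n%:R.
  exists (Num.truncn ((b - a) / (d / 2))).+1.
  by rewrite mulrC -ler_pdivrMr ?divr_gt0// ltW// truncnS_gt.
elim: n a => [|n IH] a.
  by rewrite mulr0 subr_le0 => ba ab; rewrite (le_anti (introT andP (conj ba ab))) ltxx.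
have -> : n.+1%:R = n%:R + 1 :> R by rewrite natr1.
rewrite mulrDr mulr1 => ban ab fba.
have [bd|db] := leP b (a + d / 2).
  exists (a, b); split=> //=; last by lra.
  by rewrite lt_neqAle ab andbT; apply: contraTN fba => /eqP ->; rewrite ltxx.
have [fd|fd] := ltP (f (a + d / 2)) (f a).
  by exists (a, a + d / 2); split=> //=; lra.
have [| | |[s t] /= [h1 h2 h3 h4 h5]] := IH (a + d / 2); [lra|lra|exact: lt_le_trans fd|].
by exists (s, t); split=> //=; lra.
Qed.

(** A first-order condition without derivatives: at [t = k * s] with [0 < s <= 1] the expression is
    [k ^ 2 * s * (1 - s / 2)], positive unless [k = 0]. The choice of [s] keeps [t] within [t0]. *)
Lemma stationary_shift {R : realType} (k t0 : R) : 0 < t0 ->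
  (forall t, `|t| <= t0 -> t * k - t ^+ 2 / 2 <= 0) -> k = 0.
Proof.
move=> t00 h; apply/eqP; apply: contraT => k0.
have kp : 0 < `|k| by rewrite normr_gt0.
pose s := Num.min 1 (t0 / `|k|).
have s0 : 0 < s by rewrite lt_min ltr01 divr_gt0.
have s1 : s <= 1 by rewrite ge_min lexx.
have st : `|k * s| <= t0.
  by rewrite normrM (gtr0_norm s0) mulrC -ler_pdivlMr// ge_min lexx orbT.
have := h _ st; have -> : k * s * k - (k * s) ^+ 2 / 2 = k ^+ 2 * (s * (1 - s / 2)) by field.
rewrite leNgt => /negP[]; rewrite mulr_gt0 ?exprn_even_gt0//.
by rewrite mulr_gt0//; lra.
Qed.

Section game_facts.
Context {R : realType} (N : power_stakes R) {K : nat} (E : electorate R K) (phi : {posnum R}).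
Local Notation rad := (voter_radius E).
Local Notation c0 := (center E).
Local Notation payoff := (payoff N E phi).
Local Notation C := (conflict N E).
Local Notation nash := (nash N E phi).
Local Notation draw := (tie_payoff N).
Implicit Types (x : 'rV[R]_K * 'rV[R]_K) (v y e : 'rV[R]_K) (p : party).
Hypothesis phi_big : 4 * rad ^+ 2 < phi%:num.

Let reach : R := Num.sqrt phi%:num - rad.

Lemma rad_lt_reach : rad < reach.
Proof.
rewrite /reach ltrBrDr -mulr2n -mulr_natl.
rewrite -(ltr_pXn2r (n := 2)) ?nnegrE ?mulr_ge0 ?voter_radius_ge0 ?sqrtr_ge0//.
by rewrite sqr_sqrtr// exprMn -natrX.
Qed.

Lemma reach_gt0 : 0 < reach.
Proof. exact: le_lt_trans (voter_radius_ge0 E) rad_lt_reach. Qed.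

Lemma reach_sqr v : enorm v <= reach -> (rad + enorm v) ^+ 2 <= phi%:num.
Proof.
move=> vr; rewrite -[leRHS]sqr_sqrtr//.
apply: lerXn2r; rewrite ?nnegrE ?addr_ge0 ?voter_radius_ge0 ?enorm_ge0 ?sqrtr_ge0//.
by move: vr; rewrite /reach; lra.
Qed.

Lemma payoff_reach x : enorm (x.1 - c0) <= reach -> enorm (x.2 - c0) <= reach ->
  payoff PartyA x = draw +
    (enorm (x.1 - x.2) * C (cleavage x) - norm_gap E x / 2) / phi%:num.
Proof.
case: x => a b /= ha hb; have [ab|ab] := eqVneq a b.
  by rewrite ab payoff_diag /norm_gap/= !subrr enorm0 !mul0r subr0 mul0r addr0.
by apply: payoff_conflict => //; exact: reach_sqr.
Qed.

Lemma cleavageZ (a b e : 'rV[R]_K) (r : R) : unit_sphere e -> 0 < r ->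
  a - b = r *: e -> enorm (a - b) = r /\ cleavage (a, b) = e.
Proof.
move=> e1 r0 abE; have rE : enorm (a - b) = r by rewrite abE enormZ e1 mulr1 gtr0_norm.
by split=> //; rewrite /cleavage/= rE abE scalerA mulVf ?scale1r// gt_eqF.
Qed.

(** At the symmetric profile at distance [s] along [e] both payoffs equal the draw plus
    [2 * s * C e / phi], and their sum exceeds twice the draw. The distance [reach] is known to be
    positive without discussing whether [rad] is. *)
Lemma conflict_gt0 e : unit_sphere e -> 0 < C e.
Proof.
move=> e1; have s0 := reach_gt0; set s := reach in s0.
pose x : 'rV[R]_K * 'rV[R]_K := (c0 + s *: e, c0 - s *: e).
have d1 : x.1 - x.2 = (2 * s) *: e.
  by rewrite /x/= opprB addrC addrA subrK -scalerDl -mulr2n mulr_natl.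
have d2 : x.2 - x.1 = (2 * s) *: (- e) by rewrite scalerN -d1 opprB.
have e1N : unit_sphere (- e) by rewrite /unit_sphere/= enormN.
have s20 : 0 < 2 * s by rewrite mulr_gt0.
have [r1 cl1] := cleavageZ e1 s20 d1; have [r2 cl2] := cleavageZ e1N s20 d2.
have n1 : enorm (x.1 - c0) = s by rewrite /x/= addrAC subrr add0r enormZ e1 mulr1 gtr0_norm.
have n2 : enorm (x.2 - c0) = s.
  by rewrite /x/= addrAC subrr add0r enormN enormZ e1 mulr1 gtr0_norm.
have gap1 : norm_gap E x = 0 by rewrite /norm_gap n1 n2 subrr.
have gap2 : norm_gap E (x.2, x.1) = 0 by rewrite /norm_gap n1 n2 subrr.
have PA : payoff PartyA x = draw + 2 * s * C e / phi%:num.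
  rewrite payoff_reach ?n1 ?n2// r1 gap1 mul0r subr0.
  by rewrite (_ : cleavage x = e).
have PB : payoff PartyB x = draw + 2 * s * C e / phi%:num.
  rewrite payoff_swap payoff_reach ?n1 ?n2//= r2 gap2 mul0r subr0.
  by rewrite cl2 conflictN.
have [z1 z10 Fz1] := proj_cdf_lt1_pos E e1.
have x12 : x.1 != x.2 by rewrite -subr_eq0 -enorm_gt0 r1.
(* For shocks in [[0, b]] the rescaled threshold lies in [[0, z1]], where the cdf is at least 1/2
   and below 1. *)
pose b := Num.min (2 * (2 * s) * z1) phi%:num.
have b0 : 0 < b by rewrite lt_min !mulr_gt0/=.
have b1 : b <= phi%:num by rewrite ge_min lexx orbT.
have sh z : 0 <= z <= b -> 0 < share_A E x z < 1.
  move=> /andP[z0 zb]; rewrite share_A_cdf// gap1 addr0 r1.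
  rewrite (_ : cleavage x = e)//.
  have le1 : z / (2 * (2 * s)) <= z1.
    by rewrite ler_pdivrMr ?mulr_gt0// mulrC (le_trans zb)// ge_min lexx.
  have le2 : 0 <= z / (2 * (2 * s)) by rewrite divr_ge0// mulr_ge0// ltW.
  have := ler_proj_cdf E e le1; have := ler_proj_cdf E e le2.
  by rewrite proj_cdf0 ?unit_sphere_neq0//; lra.
have p0 : - phi%:num <= 0 by rewrite oppr_le0.
have := payoff_sum_gt N p0 b0 b1 sh; rewrite PA PB => h.
have : 0 < 2 * s * C e / phi%:num by move: h; rewrite /tie_payoff; lra.
by rewrite pmulr_lgt0 ?invr_gt0// pmulr_rgt0.
Qed.

(** With [n = enorm (y - c0)], the decrease in squared distance to [v] is [n^2 - rad^2 - 2 (1 - rad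
    / n) (y - c0).(v - c0)], at least [(n - rad)^2] by Cauchy-Schwarz. Its uniformity in [v] allows
    it to be traded against a shift of the shock. *)
Lemma ball_projection y : rad < enorm (y - c0) ->
  exists2 y', enorm (y' - c0) <= rad & exists2 d : R, 0 < d &
    forall v, electorate_supp E v -> d + enorm (y' - v) ^+ 2 <= enorm (y - v) ^+ 2.
Proof.
move=> yR; have R0 := voter_radius_ge0 E.
have n0 : 0 < enorm (y - c0) by exact: le_lt_trans yR.
set n := enorm (y - c0) in yR n0.
have q0 : 0 <= rad / n by exact: divr_ge0 R0 (ltW n0).
exists (c0 + (rad / n) *: (y - c0)).
  by rewrite addrAC subrr add0r enormZ (ger0_norm q0) divfK// gt_eqF.
exists ((n - rad) ^+ 2); first by rewrite exprn_gt0// subr_gt0.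
move=> v /ler_voter_radius vR; rewrite !enorm_sqr.
have -> : y - v = (y - c0) - (v - c0) by rewrite opprB addrA subrK.
have -> : c0 + (rad / n) *: (y - c0) - v = (rad / n) *: (y - c0) - (v - c0).
  by rewrite opprB addrCA addrA.
have dn : dot (y - c0) (y - c0) = n ^+ 2 by rewrite -enorm_sqr.
have dv : dot (y - c0) (v - c0) <= n * rad.
  by apply: le_trans (ler_dot _ _) _; rewrite ler_pM2l.
move: (y - c0) (v - c0) dn dv => a w dn dv.
have -> : dot (rad / n *: a - w) (rad / n *: a - w) =
    (rad / n) ^+ 2 * n ^+ 2 - 2 * (rad / n) * dot a w + dot w w.
  by rewrite -dn !dotE (dotC w a); ring.
have -> : dot (a - w) (a - w) = n ^+ 2 - 2 * dot a w + dot w w.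
  by rewrite -dn !dotE (dotC w a); ring.
have -> : (rad / n) ^+ 2 * n ^+ 2 = rad ^+ 2 by rewrite -exprMn divfK// gt_eqF.
have h : (1 - rad / n) * dot a w <= (n - rad) * rad.
  have -> : (n - rad) * rad = (1 - rad / n) * (n * rad).
    by rewrite mulrA; congr (_ * _); rewrite mulrBl mul1r divfK// gt_eqF.
  by rewrite ler_wpM2l// subr_ge0 ler_pdivrMr// mul1r ltW.
set q := rad / n in h *; lra.
Qed.

Lemma payoff_project y v : exists2 y', enorm (y' - c0) <= rad &
  payoff PartyA (y, v) <= payoff PartyA (y', v).
Proof.
have [yR|Ry] := leP (enorm (y - c0)) rad; first by exists y.
have [y' y'R [d d0 h]] := ball_projection Ry; exists y' => //.
apply: ler_payoff => z /=; apply: share_A_ge_supp => w Sw.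
by have := h w Sw; rewrite /support_margin/=; lra.
Qed.

Lemma nash_swap x : nash x -> nash (x.2, x.1).
Proof.
case: x => a b [/= hA hB]; split=> y /=; last by rewrite !payoff_swap/=; exact: hA.
by have := hB y; rewrite !payoff_swap.
Qed.

(** Copying the opponent's platform secures the draw. *)
Lemma nash_ge_draw p x : nash x -> draw <= payoff p x.
Proof.
case: x => a b [/= hA hB]; case: p.
- by rewrite -(payoff_diag N E phi PartyA b); exact: hA.
- by rewrite -(payoff_diag N E phi PartyB a); exact: hB.
Qed.

(** With a constant share [c] the payoffs would be [nu c] and [nu (1 - c)]; both reach the draw only
    if [0 < c < 1]. The cdf would then take the same interior value at the thresholds of the shocks
    [- phi] and 0, against its strict monotonicity. *)
Lemma share_A_drop x : nash x -> exists2 z, - phi%:num <= z < phi%:num &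
  share_A E x z < share_A E x (- phi%:num).
Proof.
move=> nx; apply: contrapT => hn; set c := share_A E x (- phi%:num) in hn.
have pn : - phi%:num < phi%:num by rewrite gtrN.
have Sc z : - phi%:num <= z < phi%:num -> share_A E x z = c.
  move=> zphi; apply/eqP; rewrite eq_le share_A_noninc ?(andP zphi).1//=.
  by rewrite leNgt; apply/negP => h; apply: hn; exists z.
have /andP[c0' c1'] : 0 <= c <= 1 by exact: share_A01.
have VA : payoff PartyA x = nu N c by apply: payoff_cst => z /Sc.
have VB : payoff PartyB x = nu N (1 - c) by apply: payoff_cst => z /= /Sc ->.
have := nash_ge_draw PartyA nx; have := nash_ge_draw PartyB nx.
rewrite VA VB /tie_payoff nu1E => hB hA.
have cgt0 : 0 < c.
  by rewrite lt_neqAle c0' andbT; apply/eqP => ceq; move: hA; rewrite -ceq; lra.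
have clt1 : c < 1.
  by rewrite lt_neqAle c1' andbT; apply/eqP => ceq; move: hB; rewrite ceq subrr; lra.
have phi0 : 0 < phi%:num by [].
have [x12|x12] := eqVneq x.1 x.2.
  have : c = 1.
    by rewrite /c (surjective_pairing x) x12 share_A_diag oppr_le0 ltW.
  by move=> c1; move: clt1; rewrite c1 ltxx.
have r0 : 0 < 2 * enorm (x.1 - x.2) by rewrite mulr_gt0// enorm_gt0 subr_eq0.
have := Sc 0; have := Sc (- phi%:num); rewrite !share_A_cdf// lexx pn oppr_le0 phi0 ltW//.
move=> /(_ isT) F1 /(_ isT) F2.
have /(ltr_proj_cdf (E := E) (unit_cleavage x12)) : (- phi%:num + norm_gap E x) / (2 * enorm (x.1 - x.2)) <
    (0 + norm_gap E x) / (2 * enorm (x.1 - x.2)).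
  by rewrite ltr_pM2r ?invr_gt0// ltrD2r oppr_lt0.
by lra.
Qed.

(* A projection gains every voter a margin [d], which raises the share of A at
   each shock [z] to at least the share at [z - d]; the gain is strict near a drop
   of the share. *)
Lemma nash_ball_A x : nash x -> enorm (x.1 - c0) <= rad.
Proof.
move=> nx; rewrite leNgt; apply/negP => xR.
have [y yR [d d0 h]] := ball_projection xR.
have sh z : share_A E x (z - d) <= share_A E (y, x.2) z.
  apply: share_A_ge_supp => w Sw; have := h w Sw.
  by rewrite /support_margin/=; lra.
have [z0 /andP[z01 z02] S0] := share_A_drop nx.
have [[s t] /= [h1 h2 h3 h4 h5]] := noninc_drop (@share_A_noninc _ _ E x) d0 z01 S0.
have : payoff PartyA x < payoff PartyA (y, x.2).
  (* For [t <= z <= s + d] the old share at [z] is at most its value at [t], while the new one is at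
     least the old share at [z - d <= s], across the drop. *)
  apply: (@ltr_payoff _ N _ E phi PartyA _ _ t (Num.min (s + d) phi%:num)) => /=.
  - move=> z; apply: le_trans (sh z); apply: share_A_noninc.
    by rewrite lerBlDr lerDl ltW.
  - by lra.
  - by rewrite lt_min h4/= (le_lt_trans h3).
  - by rewrite ge_min lexx orbT.
  - move=> z /andP[tz]; rewrite le_min => /andP[zs _].
    apply: (@le_lt_trans _ _ (share_A E x t)); first exact: share_A_noninc.
    apply: (lt_le_trans h5); apply: le_trans (sh z); apply: share_A_noninc.
    by rewrite lerBlDr.
by rewrite ltNge => /negP; apply; exact: nx.1.
Qed.

Lemma nash_ball x : nash x -> ball_profile E x.
Proof.
move=> nx; split; first exact: nash_ball_A.
exact: (nash_ball_A (nash_swap nx)).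
Qed.

Let rad_reach v : enorm v <= rad -> enorm v <= reach.
Proof. by move=> /le_trans; apply; exact/ltW/rad_lt_reach. Qed.

Let lt_draw (t : R) : 0 < t -> draw < draw + t / phi%:num.
Proof. by move=> t0; rewrite ltrDl divr_gt0. Qed.

Lemma exists_unit : (0 < K)%N -> exists e : 'rV[R]_K, unit_sphere e.
Proof.
move=> K0; have i := Ordinal K0.
pose w : 'rV[R]_K := const_mx 1.
have w0 : w != 0.
  apply/eqP => /rowP /(_ (Ordinal K0)); rewrite !mxE => /eqP.
  by rewrite oner_eq0.
by exists ((enorm w)^-1 *: w); exact: enorm_normalized.
Qed.

(** From equal platforms some deviation beats the draw: towards the centre if they are elsewhere,
    away from it if they are there. *)
Lemma nash_distinct x : (0 < K)%N -> nash x -> x.1 != x.2.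
Proof.
move=> K0 nx; apply/eqP => x12; have [xR _] := nash_ball nx.
case: x x12 nx xR => a b /= <- {b} [/= hA _] aR.
rewrite /eball/= in aR.
suff [y] : exists y, draw < payoff PartyA (y, a).
  by rewrite ltNge => /negP; apply; rewrite -(payoff_diag N E phi PartyA a).
have R0 := voter_radius_ge0 E.
have [->|ac] := eqVneq a c0.
  have [e e1] := exists_unit K0; have C0 := conflict_gt0 e1.
  (* The distance [C e] maximizes [r * C e - r ^ 2 / 2], leaving a gain of [C e ^ 2 / 2] before
     division by [phi]. *)
  exists (c0 + C e *: e).
  have [|r1 cl] := @cleavageZ (c0 + C e *: e) c0 e (C e) e1 C0.
    by rewrite addrAC subrr add0r.
  rewrite payoff_reach/= ?subrr ?enorm0 ?(ltW reach_gt0)//; last first.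
    by rewrite r1 (le_trans (conflict_le_radius N E e1))// ltW// rad_lt_reach.
  rewrite r1 cl /norm_gap/= r1 subrr enorm0; apply: lt_draw.
  have := mulr_gt0 C0 C0; lra.
(* Moving to the centre gains both the conflict term and half the squared norm of [a - c0]. *)
exists c0; rewrite payoff_reach/=; [|by rewrite subrr enorm0 ltW ?reach_gt0|exact: rad_reach].
apply: lt_draw.
have cl1 : unit_sphere (cleavage (c0, a)) by apply: unit_cleavage => /=; rewrite eq_sym.
have n0 : 0 < enorm (a - c0) by rewrite enorm_gt0 subr_eq0.
have r0 : 0 < enorm (c0 - a) by rewrite enorm_gt0 subr_eq0 eq_sym.
have := mulr_gt0 r0 (conflict_gt0 cl1); have := exprn_gt0 2 n0.
rewrite /norm_gap/= subrr enorm0; lra.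
Qed.

Lemma nash_proj x : (0 < K)%N -> nash x ->
  dot (cleavage x) (x.1 - c0) = C (cleavage x).
Proof.
move=> K0 nx; have x12 := nash_distinct K0 nx; have [aR bR] := nash_ball nx.
have e1 := unit_cleavage x12; have gapE := cleavage_gap E x12.
case: x nx x12 aR bR e1 gapE => a b nx /= x12 aR bR; rewrite /eball/= in aR bR.
set e := cleavage (a, b); set r := enorm (a - b) => e1 gapE.
have r0 : 0 < r by rewrite /r enorm_gt0 subr_eq0.
have abE : a - b = r *: e by exact/esym/(cleavageE (a, b)).
(* The first bound keeps the moved platform where the payoff formula holds, the second keeps [r + t]
   positive and so the cleavage direction equal to [e]. The payoff change times [phi] is then
   exactly [t * (C e - dot e (a - c0)) - t ^ 2 / 2]. *)
pose t0 := Num.min (reach - rad) (r / 2).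
have t00 : 0 < t0 by rewrite lt_min subr_gt0 rad_lt_reach divr_gt0.
apply/eqP; rewrite eq_sym -subr_eq0; apply/eqP.
apply: (stationary_shift t00) => t tt0.
have [tr tr2] : `|t| <= reach - rad /\ `|t| <= r / 2.
  by move: tt0; rewrite le_min => /andP.
have rt : 0 < r + t by move: tr2; rewrite ler_norml; lra.
have [|rE cl] := @cleavageZ (a + t *: e) b e (r + t) e1 rt.
  by rewrite addrAC abE scalerDl.
have aR' : enorm (a + t *: e - c0) <= reach.
  rewrite addrAC (le_trans (ler_enormD _ _))// enormZ e1 mulr1; lra.
have := nx.1 (a + t *: e); rewrite /= !payoff_reach//=; try exact: rad_reach.
rewrite rE cl -/r -/e lerD2l ler_pM2r ?invr_gt0// /norm_gap/=.
have -> : enorm (a + t *: e - c0) ^+ 2 =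
    enorm (a - c0) ^+ 2 + 2 * t * dot e (a - c0) + t ^+ 2.
  by rewrite addrAC enorm_sqrDZ e1 expr1n mulr1.
lra.
Qed.

Lemma nash_value x : (0 < K)%N -> nash x ->
  enorm (x.1 - x.2) = 2 * C (cleavage x) /\
  forall p, payoff p x = draw + 2 * C (cleavage x) ^+ 2 / phi%:num.
Proof.
move=> K0 nx; have x12 := nash_distinct K0 nx.
have dA := nash_proj K0 nx; have dB := nash_proj K0 (nash_swap nx).
have clN : cleavage (x.2, x.1) = - cleavage x.
  by rewrite /cleavage/= -enormN opprB -scalerN opprB.
rewrite clN conflictN dotNl/= in dB.
have rE : enorm (x.1 - x.2) = 2 * C (cleavage x).
  by rewrite -(cleavage_gap E x12); lra.
split=> // p; have [aR bR] := nash_ball nx.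
have gap0 : norm_gap E x = 0 by rewrite norm_gapE; apply/eqP; rewrite mulf_eq0; apply/orP; right; apply/eqP; lra.
have gap0' : norm_gap E (x.2, x.1) = 0 by move: gap0; rewrite /norm_gap/=; lra.
case: p.
- rewrite payoff_reach ?rad_reach// gap0 rE; congr (_ + _ / _); ring.
- rewrite payoff_swap payoff_reach ?rad_reach//= gap0' -enormN opprB rE clN conflictN.
  by congr (_ + _ / _); ring.
Qed.


End game_facts.

(** * Maximizers of the potential and party-preferred equilibria *)

Section equilibrium_selection.
Context {R : realType} (N : power_stakes R) {K : nat} (E : electorate R K) (phi : {posnum R}).
Local Notation rad := (voter_radius E).
Local Notation c0 := (center E).
Local Notation payoff := (payoff N E phi).
Local Notation C := (conflict N E).
Local Notation Cs := (Cstar N E).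
Local Notation nash := (nash N E phi).
Local Notation draw := (tie_payoff N).
Implicit Types (x : 'rV[R]_K * 'rV[R]_K) (v y e : 'rV[R]_K) (p : party).
Hypotheses (K0 : (0 < K)%N) (phi_big : 4 * rad ^+ 2 < phi%:num).

Lemma within_continuous_conflict : {within (@unit_sphere R K), continuous C}.
Proof.
apply/subspace_continuousP => e e1; apply/cvgrPdist_lt => eps eps0.
have R0 := voter_radius_ge0 E.
have d0 : 0 < eps / (rad + 1) by rewrite divr_gt0// ltr_wpDl.
have := @continuous_enorm R K _ (@continuous_subr R K e) e.
move=> /cvgrPdist_lt/(_ _ d0) nr; rewrite near_withinE; near=> y => y1.
apply: le_lt_trans (conflict_lipschitz N E e1 y1) _.
have : `|enorm (e - e) - enorm (y - e)| < eps / (rad + 1) by near: y.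
rewrite subrr enorm0 sub0r normrN ger0_norm ?enorm_ge0// -enormN opprB.
rewrite ltr_pdivlMr ?ltr_wpDl// => /(le_lt_trans _); apply.
by rewrite mulrC ler_wpM2l ?enorm_ge0// lerDl.
Unshelve. all: by end_near. Qed.

Lemma has_sup_conflict : has_sup [set C e | e in @unit_sphere R K].
Proof.
split; first by have [e e1] := exists_unit (R := R) K0; exists (C e); exists e.
by exists rad => _ [e e1 <-]; exact: conflict_le_radius.
Qed.

Lemma conflict_le_Cstar e : unit_sphere e -> C e <= Cs.
Proof. by move=> e1; apply: sup_upper_bound; [exact: has_sup_conflict|exists e]. Qed.

Lemma DstarP e : Dstar N E e <-> unit_sphere e /\ C e = Cs.
Proof.
split=> [[e1 h]|[e1 h]]; split=> //.
- apply/eqP; rewrite eq_le conflict_le_Cstar//=; apply: ge_sup.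
    exact: has_sup_conflict.1.
  by move=> _ [e' e1' <-]; exact: h.
- by move=> e' e1'; rewrite h conflict_le_Cstar.
Qed.

Lemma Dstar_nonempty : exists e, Dstar N E e.
Proof.
have S0 : @unit_sphere R K !=set0 by have [e e1] := exists_unit (R := R) K0; exists e.
have [e] := EVT_max_rV S0 (@compact_unit_sphere R K) within_continuous_conflict.
rewrite inE => e1 h; exists e; split=> // e' e1'; apply: h; exact: mem_set.
Qed.

Lemma Cstar_gt0 : 0 < Cs.
Proof.
have [e /DstarP[e1 <-]] := Dstar_nonempty; exact: (conflict_gt0 N phi_big e1).
Qed.

Lemma Cstar_le_radius : Cs <= rad.
Proof. by have [e /DstarP[e1 <-]] := Dstar_nonempty; exact: conflict_le_radius. Qed.

Lemma DstarN e : Dstar N E e -> Dstar N E (- e).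
Proof.
move=> /DstarP[e1 eC]; apply/DstarP; split; last by rewrite conflictN.
by rewrite /unit_sphere/= enormN.
Qed.

Lemma symmetric_profileN e :
  symmetric_profile N E (- e) = ((symmetric_profile N E e).2, (symmetric_profile N E e).1).
Proof. by rewrite /symmetric_profile/= scalerN opprK. Qed.

Lemma symmetric_profile_diff e : (symmetric_profile N E e).1 - (symmetric_profile N E e).2 =
  (2 * Cs) *: e.
Proof. by rewrite /= opprB addrC addrA subrK -scalerDl -mulr2n mulr_natl. Qed.

Lemma symmetric_profile_cleavage e : unit_sphere e ->
  enorm ((symmetric_profile N E e).1 - (symmetric_profile N E e).2) = 2 * Cs /\
  cleavage (symmetric_profile N E e) = e.
Proof.
move=> e1; apply: cleavageZ e1 _ (symmetric_profile_diff e).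
by rewrite mulr_gt0// Cstar_gt0.
Qed.

Lemma symmetric_profile_ball e : unit_sphere e -> ball_profile E (symmetric_profile N E e).
Proof.
move=> e1; split; rewrite /eball/= addrAC subrr add0r ?enormN enormZ e1 mulr1;
  by rewrite (gtr0_norm Cstar_gt0) Cstar_le_radius.
Qed.

Lemma potentialE x : ball_profile E x ->
  potential N E phi x = draw + (enorm (x.1 - x.2) * C (cleavage x) -
    enorm (x.1 - x.2) ^+ 2 / 4 - enorm ((x.1 - c0) + (x.2 - c0)) ^+ 2 / 4) / phi%:num.
Proof.
case: x => a b [/= aR bR]; rewrite /eball/= in aR bR.
have h := ltW (rad_lt_reach phi_big).
rewrite /potential payoff_reach//=; [|exact: le_trans h|exact: le_trans h].
have -> : a - b = (a - c0) - (b - c0) by rewrite opprB addrA subrK.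
rewrite -addrA -mulrBl; congr (_ + _ / _); rewrite /norm_gap/=.
move: (enorm (a - c0 - (b - c0)) * C (cleavage (a, b))) (a - c0) (b - c0) => k u w.
by rewrite !enorm_sqr !dotE (dotC w u); field.
Qed.

(** Times [phi], the defect of the bound is a sum of three nonnegative terms:
    [r * (Cs - C (cleavage x))], [(Cs - r / 2) ^ 2] and a quarter of the squared norm of the sum of
    the centred platforms. Equality cancels each, which forces the symmetric form. *)
Lemma potential_le x : ball_profile E x ->
  potential N E phi x <= draw + Cs ^+ 2 / phi%:num /\
  (potential N E phi x = draw + Cs ^+ 2 / phi%:num ->
   exists2 e, Dstar N E e & x = symmetric_profile N E e).
Proof.
move=> xB; rewrite potentialE//; set r := enorm _; set s := enorm (_ + _).
have r0 : 0 <= r by exact: enorm_ge0.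
have C0 := Cstar_gt0.
have rC : r * C (cleavage x) <= r * Cs.
  (* At equal platforms the cleavage is not a unit vector, but the factor [r] vanishes. *)
  have [x12|x12] := eqVneq x.1 x.2; first by rewrite /r x12 subrr enorm0 !mul0r.
  by rewrite ler_wpM2l// conflict_le_Cstar//; exact: unit_cleavage.
have sq : r * Cs - r ^+ 2 / 4 = Cs ^+ 2 - (Cs - r / 2) ^+ 2 by field.
have s2 := sqr_ge0 s; have q2 := sqr_ge0 (Cs - r / 2).
split; first by rewrite lerD2l ler_pM2r ?invr_gt0//; lra.
have pn : (phi%:num)^-1 != 0 by rewrite invr_eq0 gt_eqF.
move=> /addrI/(mulIf pn) eqC.
have /eqP : s ^+ 2 = 0 by lra.
rewrite expf_eq0/= => s0; have /eqP : (Cs - r / 2) ^+ 2 = 0 by lra.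
rewrite expf_eq0/= => /eqP rE.
have r2 : r = 2 * Cs by lra.
have rn0 : 0 < r by rewrite r2 mulr_gt0.
have x12 : x.1 != x.2 by rewrite -subr_eq0 -enorm_gt0.
have CE : C (cleavage x) = Cs.
  by apply: (mulfI (lt0r_neq0 rn0)); lra.
exists (cleavage x); first by apply/DstarP; split=> //; exact: unit_cleavage.
have d := cleavageE x; rewrite -/r r2 in d.
move: s0; rewrite enorm_eq0 => /eqP s0.
have two : (2 : R) != 0 by [].
have ab : x.1 - c0 = Cs *: cleavage x.
  apply: (scalerI two); rewrite scalerA d scaler_nat mulr2n.
  by rewrite -[LHS]subr0 -s0 opprD addrA addrK opprB addrA subrK.
have ba : x.2 - c0 = - (Cs *: cleavage x) by rewrite -ab; apply/eqP; rewrite -addr_eq0 addrC s0.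
rewrite /symmetric_profile [LHS]surjective_pairing.
by congr pair; [rewrite -ab addrC subrK|rewrite -ba addrC subrK].
Qed.

Lemma potential_symmetric e : Dstar N E e ->
  potential N E phi (symmetric_profile N E e) = draw + Cs ^+ 2 / phi%:num.
Proof.
move=> /DstarP[e1 eC]; rewrite potentialE; last exact: symmetric_profile_ball.
have [-> ->] := symmetric_profile_cleavage e1; rewrite eC.
have -> : (symmetric_profile N E e).1 - c0 + ((symmetric_profile N E e).2 - c0) = 0.
  by rewrite /= !(addrC c0) !addrK subrr.
by rewrite enorm0; congr (_ + _ / _); field.
Qed.

Lemma potential_maximizerP x : potential_maximizer N E phi x <->
  exists2 e, Dstar N E e & x = symmetric_profile N E e.
Proof.
split=> [[xB xmax]|[e De ->]].
  have [le1] := potential_le xB; apply.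
  apply/eqP; rewrite eq_le le1/=; have [e De] := Dstar_nonempty.
  rewrite -(potential_symmetric De); apply: xmax; apply: symmetric_profile_ball.
  by have /DstarP[] := De.
have /DstarP[e1 _] := De.
split; first exact: symmetric_profile_ball.
by move=> y /potential_le[h _]; rewrite potential_symmetric.
Qed.

(** The potential differs from A's payoff by a term in B's platform alone, so a maximizer is a best
    reply of A within the ball; a deviation outside it is first projected. *)
Lemma maximizer_deviation x y : potential_maximizer N E phi x ->
  payoff PartyA (y, x.2) <= payoff PartyA x.
Proof.
move=> [xB xmax]; have [y' y'R] := payoff_project N E phi y x.2.
move/le_trans; apply; have := xmax (y', x.2).
rewrite /potential/= lerD2r; apply; split=> //=.
exact: xB.2.
Qed.

Lemma potential_maximizer_nash x : potential_maximizer N E phi x -> nash x.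
Proof.
(* The definition of the potential favours A; B's deviations are handled at the exchanged profile,
   again a maximizer because [Dstar] is stable under opposition. *)
move=> xm; have xm' : potential_maximizer N E phi (x.2, x.1).
  have /potential_maximizerP[e De ->] := xm.
  by apply/potential_maximizerP; exists (- e); [exact: DstarN|rewrite symmetric_profileN].
split=> y; first exact: maximizer_deviation.
by have := maximizer_deviation y xm'; rewrite !payoff_swap.
Qed.

Lemma symmetric_profile_nash e : Dstar N E e -> nash (symmetric_profile N E e).
Proof.
by move=> De; apply: potential_maximizer_nash; apply/potential_maximizerP; exists e.
Qed.

Let value (t : R) : R := draw + 2 * t ^+ 2 / phi%:num.

Let ler_value (s t : R) : 0 <= s -> 0 <= t -> (value s <= value t) = (s <= t).
Proof.
by move=> s0 t0; rewrite lerD2l ler_pM2r ?invr_gt0// ler_pM2l// ler_pXn2r.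
Qed.

Lemma nash_le_value p x : nash x -> payoff p x <= value Cs.
Proof.
move=> nx; have [_ ->] := nash_value phi_big K0 nx.
have e1 := unit_cleavage (nash_distinct phi_big K0 nx).
by rewrite -/(value _) ler_value ?conflict_le_Cstar// ltW ?Cstar_gt0// (conflict_gt0 N phi_big).
Qed.

Lemma symmetric_profile_value p e : Dstar N E e ->
  payoff p (symmetric_profile N E e) = value Cs.
Proof.
move=> De; have [_ ->] := nash_value phi_big K0 (symmetric_profile_nash De).
have /DstarP[e1 eC] := De.
by have [_ ->] := symmetric_profile_cleavage e1; rewrite eC.
Qed.

(** Equilibrium payoffs are the same increasing function of [C (cleavage x)] for both parties, so
    they rank equilibria alike; the maximizers of the potential supply an equilibrium that attains
    the top value. *)
Lemma party_preferredP x : nash x ->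
  party_preferred N E phi x <-> x.1 <> x.2 /\ Dstar N E (cleavage x).
Proof.
move=> nx; have x12 := nash_distinct phi_big K0 nx.
have e1 := unit_cleavage x12; have [_ vx] := nash_value phi_big K0 nx.
split=> [[_ best]|[_ /DstarP[_ eC]]].
  split; first exact/eqP.
  apply/DstarP; split=> //; apply/eqP; rewrite eq_le conflict_le_Cstar//=.
  have [e De] := Dstar_nonempty.
  have := best PartyA _ (symmetric_profile_nash De).
  rewrite symmetric_profile_value// vx -/(value _) ler_value//.
    exact/ltW/Cstar_gt0.
  exact/ltW/(conflict_gt0 N phi_big).
split=> // p y ny; rewrite vx eC; exact: nash_le_value.
Qed.

Lemma party_preferred_value x : party_preferred N E phi x ->
  enorm (x.1 - x.2) = 2 * Cs /\ forall p, payoff p x = value Cs.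
Proof.
move=> px; have nx := px.1; have [_ /DstarP[_ eC]] := (party_preferredP nx).1 px.
by have := nash_value phi_big K0 nx; rewrite eC.
Qed.

Lemma max_equilibrium_payoffE p : max_equilibrium_payoff N E phi p = value Cs.
Proof.
have [e De] := Dstar_nonempty; have ne := symmetric_profile_nash De.
apply/eqP; rewrite eq_le; apply/andP; split.
  apply: ge_sup; first by exists (payoff p (symmetric_profile N E e)); exists (symmetric_profile N E e).
  by move=> _ [x nx <-]; exact: nash_le_value.
apply: sup_upper_bound; last by exists (symmetric_profile N E e) => //; exact: symmetric_profile_value.
split; first by exists (payoff p (symmetric_profile N E e)); exists (symmetric_profile N E e).
by exists (value Cs) => _ [x nx <-]; exact: nash_le_value.
Qed.

End equilibrium_selection.

Theorem proposition6 (R : realType) (N : power_stakes R) (phi : {posnum R})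
    (K : nat) (E : electorate R K) :
  (2 <= K)%N -> 4 * voter_radius E ^+ 2 < phi%:num ->
  (exists2 e, Dstar N E e & conflict N E e = Cstar N E) /\
  (forall x : 'rV[R]_K * 'rV[R]_K,
     potential_maximizer N E phi x <->
     exists2 e, Dstar N E e &
       x = symmetric_profile N E e \/
       x = ((symmetric_profile N E e).2, (symmetric_profile N E e).1)) /\
  (forall x : 'rV[R]_K * 'rV[R]_K,
     potential_maximizer N E phi x -> nash N E phi x) /\
  (forall x : 'rV[R]_K * 'rV[R]_K, nash N E phi x ->
     (party_preferred N E phi x <->
      x.1 <> x.2 /\ Dstar N E (cleavage x))) /\
  (forall x : 'rV[R]_K * 'rV[R]_K, party_preferred N E phi x ->
     enorm (x.1 - x.2) = 2 * Cstar N E /\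
     forall p : party, payoff N E phi p x =
       (nu N 1 + nu N 0) / 2 + 2 * Cstar N E ^+ 2 / phi%:num) /\
  (forall (K' : nat) (E' : electorate R K'),
     (2 <= K')%N -> 4 * voter_radius E' ^+ 2 < phi%:num ->
     Cstar N E < Cstar N E' ->
     forall p : party, max_equilibrium_payoff N E phi p <
                       max_equilibrium_payoff N E' phi p).
Proof.
move=> K2 phi_big; have K0 : (0 < K)%N by exact: ltnW.
split; first by have [e De] := Dstar_nonempty N E K0; exists e => //; have /(DstarP N E K0)[] := De.
split.
  move=> x; split.
    by move=> /(potential_maximizerP N K0 phi_big)[e De ->]; exists e => //; left.
  move=> [e De [->|->]]; apply/(potential_maximizerP N K0 phi_big); first by exists e.
  by exists (- e); [exact: DstarN|rewrite symmetric_profileN].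
split; first exact: potential_maximizer_nash.
split; first exact: party_preferredP.
split.
  by move=> x /(party_preferred_value K0 phi_big); rewrite (addrC (nu N 1)).
move=> K' E' K2' phi_big' CC p; have K0' : (0 < K')%N by exact: ltnW.
rewrite !max_equilibrium_payoffE// ltrD2l ltr_pM2r ?invr_gt0// ltr_pM2l//.
have C0 := Cstar_gt0 N K0 phi_big; have C0' := Cstar_gt0 N K0' phi_big'.
by rewrite ltr_pXn2r// nnegrE ltW.
Qed.
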